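(* Let $m,J\in\mathbb Z_{\ge1}$ and $s,r,\gamma\in\mathbb R$ with $r>0$ and $\gamma>J+1$. For the dynamical $(J;\gamma)$-PEP set $$\mathfrak H_T(s,r;\gamma)=T^{-1/4}\,\mathfrak h_{\lfloor rT\rfloor}\Big(\Big\lfloor\frac{JrT}{J+1}+sT^{1/4}\Big\rfloor\Big).$$ Then $$\lim_{T\to\infty}\mathbb E\Big[\mathfrak H_T(s,r;\gamma)^m\big(\mathfrak H_T(s,r;\gamma)+s(J+1)\big)^m\Big]=\Big(\frac{rJ}{2\pi}\Big)^{m/2}(\gamma)_m=\mathbb E[\chi_{a,b}^m],$$ where $a=\gamma$, $b=\sqrt{2\pi/(rJ)}$, $(\gamma)_m=\prod_{j=0}^{m-1}(\gamma+j)$, and $\chi_{a,b}$ is a Gamma random variable with density $\Gamma(a)^{-1}b^ax^{a-1}e^{-bx}$ on $x>0$.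
   Context: Dynamical $(J;\gamma)$-PEP: fix $J\in\mathbb Z_{>0}$ and real $\gamma>J+1$. It is a discrete-time Markov process $\eta(t)=(\eta_1(t),\eta_2(t),\dots)$, $t\in\mathbb Z_{\ge0}$, with $\eta_k(t)\in\{0,1,\dots,J+1\}$, started from $\eta_k(0)=0$ for all $k$. Define $\mathfrak h_t(x)=\sum_{j\ge x}\eta_j(t)$, $\mathfrak a_t(x)=\sum_{j=1}^{x-1}(J+1-\eta_j(t))$, and $\Upsilon(k;t)=\gamma+\mathfrak h_t(k)+\mathfrak a_t(k)$. Given $\eta(t)$, set $X_0(t)=J$ and let $X_1(t),X_2(t),\dots$ be conditionally independent with $X_k(t)\in\{\eta_k(t)-1,\eta_k(t)\}$, $$\mathbb P[X_k(t)=\eta_k(t)-1]=\frac{\eta_k(t)}{J+1}\Big(1+\frac{J+1-\eta_k(t)}{\Upsilon(k;t)}\Big),\quad \mathbb P[X_k(t)=\eta_k(t)]=\frac{J+1-\eta_k(t)}{J+1}\Big(1-\frac{\eta_k(t)}{\Upsilon(k;t)}\Big);$$ then $\eta_k(t+1)=\eta_k(t)-X_k(t)+X_{k-1}(t)$ for $k\ge1$. *)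

(* Defs.v *)
From Stdlib Require Import Reals ZArith List.
Import ListNotations.
Open Scope R_scope.

(* A configuration eta : nat -> Z, with eta k = eta_k for k >= 1 (eta 0 unused). *)
Definition config := nat -> Z.

Fixpoint sumR (f : nat -> R) (n : nat) : R :=
  match n with O => 0 | S n' => sumR f n' + f n end.

(* h(x) = sum_{j >= x, j >= 1} eta_j, for a configuration supported in [1,B] *)
Definition hgt (B : nat) (eta : config) (x : Z) : R :=
  sumR (fun j => if Z.leb x (Z.of_nat j) then IZR (eta j) else 0) B.

Definition agap (J : nat) (eta : config) (k : nat) : R :=
  sumR (fun j => INR J + 1 - IZR (eta j)) (k - 1).

Definition Ups (J : nat) (gamma : R) (B : nat) (eta : config) (k : nat) : R :=
  gamma + hgt B eta (Z.of_nat k) + agap J eta k.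

Definition pdown J gamma B (eta : config) k : R :=
  let e := IZR (eta k) in
  e / (INR J + 1) * (1 + (INR J + 1 - e) / Ups J gamma B eta k).

Definition pstay J gamma B (eta : config) k : R :=
  let e := IZR (eta k) in
  (INR J + 1 - e) / (INR J + 1) * (1 - e / Ups J gamma B eta k).

Definition upd (X : config) (n : nat) (v : Z) : config :=
  fun k => if Nat.eqb k n then v else X k.

(* Joint law of (X_0 = J, X_1, ..., X_n) as a weighted list; for k > n, X_k := eta_k
   (which is 0 = the a.s. value when eta_k = 0). *)
Fixpoint choices J gamma B (eta : config) (n : nat) : list (R * config) :=
  match n with
  | O => [(1, fun k => if Nat.eqb k 0 then Z.of_nat J else eta k)]
  | S n' =>
      flat_map (fun p : R * config => let (w, X) := p in
        [(w * pdown J gamma B eta n, upd X n (eta n - 1)%Z);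
         (w * pstay J gamma B eta n, upd X n (eta n))])
        (choices J gamma B eta n')
  end.

Definition newconf (eta X : config) : config :=
  fun k => match k with O => 0%Z | S k' => (eta k - X k + X k')%Z end.

(* Law of eta(t) as a finite weighted list (eta(t) is supported in [1,t]). *)
Fixpoint law (J : nat) (gamma : R) (t : nat) : list (R * config) :=
  match t with
  | O => [(1, fun _ => 0%Z)]
  | S t' =>
      flat_map (fun p : R * config => let (w, eta) := p in
        map (fun q : R * config => let (w', X) := q in (w * w', newconf eta X))
            (choices J gamma (S t') eta (S t')))
        (law J gamma t')
  end.

Definition Expect (J : nat) (gamma : R) (t : nat) (g : config -> R) : R :=
  fold_right (fun p acc => fst p * g (snd p) + acc) 0 (law J gamma t).

Definition Htime (r T : R) : nat := Z.to_nat (Int_part (r * T)).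
Definition Hval (J : nat) (s r T : R) (eta : config) : R :=
  hgt (Htime r T) eta (Int_part (INR J * r * T / (INR J + 1) + s * Rpower T (1/4)))
    / Rpower T (1/4).

Fixpoint poch (g : R) (m : nat) : R :=
  match m with O => 1 | S m' => poch g m' * (g + INR m') end.

Definition improper_integral0 (f : R -> R) (L : R) : Prop :=
  (forall M, 0 <= M -> inhabited (Riemann_integrable f 0 M)) /\
  (forall eps, 0 < eps -> exists M0, forall M (pr : Riemann_integrable f 0 M),
      M0 <= M -> Rabs (RiemannInt pr - L) < eps).

(* Gamma(a) integrand and Gamma(a,b) density (with Gamma(a) = G) *)
Definition gamma_kernel (a : R) (x : R) : R :=
  if Rlt_dec 0 x then Rpower x (a - 1) * exp (- x) else 0.
Definition gamma_density (a b G : R) (x : R) : R :=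
  if Rlt_dec 0 x then / G * Rpower b a * Rpower x (a - 1) * exp (- (b * x)) else 0.

(* Main.v *)
(** The idea is a duality that compares the dynamical process with its limit [gamma = oo],
    in which [X_k = eta_k - 1] has probability [eta_k / (J+1)].  For positions
    [x_1 >= x_2 >= ...] the functions [prod_i (h(x_i) - i + 1) (a(x_i) + gamma + i - 1)] of
    the dynamical process and [prod_i (h(x_i) - i + 1)] of the limiting process satisfy the
    same linear evolution: among [k] dual particles sharing a site one lags behind, with
    (possibly signed) weight [k / (J+1)].  At the left boundary [a = 0], so the two families
    differ there only by a Pochhammer factor, and hence
    [E_gamma[(h)_m (a + gamma)^(m)] = (gamma)_m E_oo[(h)_m]] exactly, with falling and rising
    factorials on the left.
    In the limiting process [h] is dominated by a Poisson variable in the sense of generating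
    functions, which gives [E h^2 <= u^2 + O(u)] and [E h^m = O(u^m)] for [u = E h]; therefore
    [E (h)_m ~ u^m].  The mean [u] is a truncated binomial mean, explicit by de Moivre's formula,
    and Stirling gives [u ~ sqrt (r J T / (2 pi))].  Replacing the factorials by powers costs
    lower-order terms. *)
From Coquelicot Require Import Coquelicot.
Require Import Defs.
From Stdlib Require Import Reals ZArith List Lia Lra.
Import ListNotations.
Open Scope R_scope.

(** The new height and gap at [x + 1] are the old pair [(h, a)] at [x], changed to [(h - 1, a)] or
    [(h, a + 1)] by the single variable [X (S x)]. Such a shift exchanges one end factor of a
    falling or rising factorial, so the mean over a whole cluster reduces to an identity between
    single factors; there [(h - c) + (a + gamma + c)] is exactly the denominator [Ups]. Clusters at
    distinct sites involve independent variables. Since the dual weights leave [[0, 1]] once a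
    cluster has more than [J + 1] particles, the comparison is an induction on time over linear
    identities, not a coupling with a dual Markov chain. The scales fit because the dynamical height
    is of order [T^(1/4)] and the limiting one of order [T^(1/2)], which the product [h (a + gamma)]
    restores. As [a - h] is deterministic, this product is a quadratic polynomial in [h] alone:
    hence the two factors in the theorem. *)

(** * Expectations over finite weighted lists *)

Definition wsum {A : Type} (l : list (R * A)) (g : A -> R) : R :=
  fold_right (fun p acc => fst p * g (snd p) + acc) 0 l.

Lemma wsum_app {A} (l1 l2 : list (R * A)) g :
  wsum (l1 ++ l2) g = wsum l1 g + wsum l2 g.
Proof. induction l1 as [|p l IH]; simpl; [ring | rewrite IH; ring]. Qed.

Lemma wsum_plus {A} (l : list (R * A)) f g :
  wsum l (fun x => f x + g x) = wsum l f + wsum l g.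
Proof. induction l as [|p l IH]; simpl; [ring | rewrite IH; ring]. Qed.

Lemma wsum_scal {A} (l : list (R * A)) c f :
  wsum l (fun x => c * f x) = c * wsum l f.
Proof. induction l as [|p l IH]; simpl; [ring | rewrite IH; ring]. Qed.

Lemma wsum_ext {A} (l : list (R * A)) f g :
  (forall x, f x = g x) -> wsum l f = wsum l g.
Proof. intros H; induction l as [|p l IH]; simpl; [reflexivity | rewrite IH, H; ring]. Qed.

Lemma wsum_map {A B} (l : list (R * A)) w (F : A -> B) (g : B -> R) :
  wsum (map (fun q : R * A => let (w', x) := q in (w * w', F x)) l) g
  = w * wsum l (fun x => g (F x)).
Proof. induction l as [|[w' x] l IH]; simpl; [ring | rewrite IH; ring]. Qed.

(** The lists also enumerate impossible branches, such as a particle leaving an empty site. These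
    carry weight zero, so the property is asked only at positive weight. *)
Definition supported {A : Type} (l : list (R * A)) (P : A -> Prop) : Prop :=
  Forall (fun p => 0 <= fst p /\ (0 < fst p -> P (snd p))) l.

Lemma wsum_ext_supp {A} (l : list (R * A)) (P : A -> Prop) f g :
  supported l P -> (forall x, P x -> f x = g x) -> wsum l f = wsum l g.
Proof.
  intros Hl H; induction Hl as [|[w x] l [H0 H1] _ IH]; simpl in *; [reflexivity|].
  rewrite IH. destruct H0 as [H0|H0]; [rewrite H; auto | rewrite <- H0; ring].
Qed.

Lemma wsum_le_supp {A} (l : list (R * A)) (P : A -> Prop) f g :
  supported l P -> (forall x, P x -> f x <= g x) -> wsum l f <= wsum l g.
Proof.
  intros Hl H; induction Hl as [|[w x] l [H0 H1] _ IH]; simpl in *; [lra|].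
  destruct H0 as [H0|H0].
  - specialize (H x (H1 H0)). nra.
  - rewrite <- H0. lra.
Qed.

(** * The process with general jump probabilities *)

Fixpoint choicesG (J : nat) (pd ps : nat -> R) (eta : config) (n : nat) : list (R * config) :=
  match n with
  | O => [(1, fun k => if Nat.eqb k 0 then Z.of_nat J else eta k)]
  | S n' =>
      flat_map (fun p : R * config => let (w, X) := p in
        [(w * pd n, upd X n (eta n - 1)%Z); (w * ps n, upd X n (eta n))])
        (choicesG J pd ps eta n')
  end.

(** The jump probabilities are parameters so that the dynamical process and its limit share one
    development. Their first argument is the cutoff [B] at which heights are summed, here [S t'],
    beyond every occupied site. *)
Fixpoint lawG (J : nat) (P Q : nat -> config -> nat -> R) (t : nat) : list (R * config) :=
  match t with
  | O => [(1, fun _ => 0%Z)]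
  | S t' =>
      flat_map (fun p : R * config => let (w, eta) := p in
        map (fun q : R * config => let (w', X) := q in (w * w', newconf eta X))
            (choicesG J (P (S t') eta) (Q (S t') eta) eta (S t')))
        (lawG J P Q t')
  end.

Lemma choices_choicesG J g B eta n :
  choices J g B eta n = choicesG J (pdown J g B eta) (pstay J g B eta) eta n.
Proof. induction n as [|n IH]; simpl; [reflexivity | rewrite IH; reflexivity]. Qed.

Lemma law_lawG J g t : law J g t = lawG J (pdown J g) (pstay J g) t.
Proof.
  induction t as [|t IH]; simpl law; simpl lawG; [reflexivity|]. rewrite IH.
  apply flat_map_ext. intros [w eta]. rewrite <- choices_choicesG. reflexivity.
Qed.

Lemma wsum_choicesG_S J pd ps eta n g :
  wsum (choicesG J pd ps eta (S n)) g =
  wsum (choicesG J pd ps eta n) (fun X =>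
    pd (S n) * g (upd X (S n) (eta (S n) - 1)%Z) + ps (S n) * g (upd X (S n) (eta (S n)))).
Proof.
  simpl. induction (choicesG J pd ps eta n) as [|[w X] l IH]; simpl; [reflexivity|].
  rewrite IH. ring.
Qed.

Lemma wsum_lawG_S J P Q t g :
  wsum (lawG J P Q (S t)) g =
  wsum (lawG J P Q t) (fun eta =>
    wsum (choicesG J (P (S t) eta) (Q (S t) eta) eta (S t)) (fun X => g (newconf eta X))).
Proof.
  cbn [lawG]. induction (lawG J P Q t) as [|[w X] l IH]; [reflexivity|].
  cbn [flat_map]. rewrite wsum_app, IH, wsum_map. reflexivity.
Qed.

Definition depends_upto (k : nat) (g : config -> R) : Prop :=
  forall X Y : config, (forall i, (i <= k)%nat -> X i = Y i) -> g X = g Y.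

Lemma upd_eq X n v : upd X n v n = v.
Proof. unfold upd. now rewrite Nat.eqb_refl. Qed.

Lemma upd_neq X n v k : k <> n -> upd X n v k = X k.
Proof. intros H. unfold upd. apply Nat.eqb_neq in H. now rewrite H. Qed.

(** Coordinates are chosen from left to right, so those beyond [k] can be summed out one by one,
    each with total weight 1. *)
Lemma choicesG_truncate J pd ps eta k n g :
  depends_upto k g -> (k <= n)%nat ->
  (forall i, (k < i <= n)%nat -> pd i + ps i = 1) ->
  wsum (choicesG J pd ps eta n) g = wsum (choicesG J pd ps eta k) g.
Proof.
  intros Hg Hk. induction Hk as [|n Hk IH]; intros H1; [reflexivity|].
  rewrite wsum_choicesG_S. rewrite <- IH by (intros; apply H1; lia).
  apply wsum_ext. intros X.
  rewrite (Hg (upd X (S n) _) X), (Hg (upd X (S n) (eta (S n))) X).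
  - replace (pd (S n) * g X + ps (S n) * g X) with ((pd (S n) + ps (S n)) * g X) by ring.
    rewrite H1 by lia. ring.
  - intros; apply upd_neq; lia.
  - intros; apply upd_neq; lia.
Qed.

(** This is the independence of [X (S k)] from [X 1, ..., X k]: the later coordinates are summed
    out, and then the last remaining one is split off. *)
Lemma choicesG_peel J pd ps eta k n (f : Z -> R) g :
  depends_upto k g -> (k < n)%nat ->
  (forall i, (1 <= i <= n)%nat -> pd i + ps i = 1) ->
  wsum (choicesG J pd ps eta n) (fun X => f (X (S k)) * g X) =
  (pd (S k) * f (eta (S k) - 1)%Z + ps (S k) * f (eta (S k)))
    * wsum (choicesG J pd ps eta k) g.
Proof.
  intros Hg Hk H1.
  rewrite (choicesG_truncate J pd ps eta (S k) n); [| | lia | intros; apply H1; lia].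
  - rewrite wsum_choicesG_S, <- wsum_scal. apply wsum_ext. intros X.
    rewrite !upd_eq.
    rewrite (Hg (upd X (S k) _) X), (Hg (upd X (S k) (eta (S k))) X).
    + ring.
    + intros; apply upd_neq; lia.
    + intros; apply upd_neq; lia.
  - intros X Y HXY. rewrite (Hg X Y), (HXY (S k)); auto.
Qed.

(** * Prefix sums and admissible configurations *)

Definition psum (eta : config) (k : nat) : R := sumR (fun j => IZR (eta j)) k.

(* [hh J t eta k] and [aa J eta k] are the paper's h_t(k+1) and a_t(k+1). *)
Definition hh (J t : nat) (eta : config) (k : nat) : R := INR J * INR t - psum eta k.
Definition aa (J : nat) (eta : config) (k : nat) : R := (INR J + 1) * INR k - psum eta k.

(** The last clause is conservation of mass: [J] particles enter per step and none is lost. It makes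
    [hh], which is written with a finite prefix sum, the true height to the right. *)
Definition valid (J t : nat) (eta : config) : Prop :=
  (forall k, (1 <= k)%nat -> (0 <= eta k <= Z.of_nat J + 1)%Z) /\
  (forall k, (t < k)%nat -> eta k = 0%Z) /\
  psum eta t = INR J * INR t.

(** The two vanishing conditions forbid leaving an empty site and staying put at a full one; they
    keep the occupation numbers in [[0, J + 1]]. *)
Definition admissible (J : nat) (P Q : nat -> config -> nat -> R) : Prop :=
  forall t eta k, valid J t eta -> (1 <= k)%nat ->
    0 <= P (S t) eta k /\ 0 <= Q (S t) eta k /\ P (S t) eta k + Q (S t) eta k = 1 /\
    (eta k = 0%Z -> P (S t) eta k = 0) /\
    (eta k = (Z.of_nat J + 1)%Z -> Q (S t) eta k = 0).

Lemma sumR_ext f g n : (forall j, (1 <= j <= n)%nat -> f j = g j) -> sumR f n = sumR g n.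
Proof.
  induction n as [|n IH]; intros H; simpl; [reflexivity|].
  rewrite IH, (H (S n)) by (intros; apply H || lia; lia). reflexivity.
Qed.

Lemma psum_newconf eta X k :
  psum (newconf eta X) k = psum eta k + IZR (X O) - IZR (X k).
Proof.
  unfold psum. induction k as [|k IH]; simpl; [ring|].
  rewrite IH, plus_IZR, minus_IZR. ring.
Qed.

Lemma psum_S eta k : psum eta (S k) = psum eta k + IZR (eta (S k)).
Proof. reflexivity. Qed.

Lemma psum_stable J t eta k : valid J t eta -> (t <= k)%nat -> psum eta k = INR J * INR t.
Proof.
  intros (_ & H0 & Hs) Hk. induction Hk as [|k Hk IH]; [exact Hs|].
  rewrite psum_S, IH, H0 by lia. ring.
Qed.

Lemma hh_out J t eta k : valid J t eta -> (t <= k)%nat -> hh J t eta k = 0.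
Proof. intros H Hk. unfold hh. rewrite (psum_stable J t eta k H Hk). ring. Qed.

Lemma hh_S J t eta k : hh J t eta (S k) = hh J t eta k - IZR (eta (S k)).
Proof. unfold hh. rewrite psum_S. ring. Qed.

Lemma aa_S J eta k : aa J eta (S k) = aa J eta k + (INR J + 1 - IZR (eta (S k))).
Proof. unfold aa. rewrite psum_S, S_INR. ring. Qed.

Lemma valid_IZR J t eta k : valid J t eta -> (1 <= k)%nat ->
  0 <= IZR (eta k) <= INR J + 1.
Proof.
  intros (H & _) Hk. specialize (H k Hk). rewrite INR_IZR_INZ, <- plus_IZR.
  split; apply IZR_le; lia.
Qed.

Lemma hh_nonneg J t eta k : valid J t eta -> 0 <= hh J t eta k.
Proof.
  intros H. destruct (Nat.le_gt_cases t k) as [Hk|Hk].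
  - rewrite hh_out by assumption. lra.
  - replace t with (t - k + k)%nat in * by lia.
    (* Descent from the site [t], where the height is 0: each site passed on the way left adds a
       nonnegative occupation number. *)
    assert (G : forall d, 0 <= hh J (t - k + k) eta k - hh J (t - k + k) eta (d + k)).
    { induction d as [|d IH]; simpl; [lra|]. rewrite hh_S.
      pose proof (valid_IZR _ _ _ (S (d + k)) H ltac:(lia)). lra. }
    specialize (G (t - k)%nat). rewrite (hh_out _ _ _ (t - k + k)%nat) in G by (auto; lia). lra.
Qed.

Lemma aa_nonneg J t eta k : valid J t eta -> 0 <= aa J eta k.
Proof.
  intros H. induction k as [|k IH].
  - unfold aa, psum; simpl; lra.
  - rewrite aa_S. pose proof (valid_IZR _ _ _ (S k) H ltac:(lia)). lra.
Qed.

Lemma supported_choicesG J pd ps eta n :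
  (forall k, (1 <= k <= n)%nat -> 0 <= pd k /\ 0 <= ps k /\
     (eta k = 0%Z -> pd k = 0) /\ (eta k = (Z.of_nat J + 1)%Z -> ps k = 0)) ->
  (forall k, (1 <= k)%nat -> (0 <= eta k <= Z.of_nat J + 1)%Z) ->
  supported (choicesG J pd ps eta n) (fun X =>
    X O = Z.of_nat J /\
    (forall k, (1 <= k <= n)%nat -> (X k = eta k - 1 /\ 1 <= eta k)%Z \/
                                   (X k = eta k /\ eta k <= Z.of_nat J)%Z) /\
    (forall k, (n < k)%nat -> X k = eta k)).
Proof.
  intros Hp Hv. induction n as [|n IH].
  - repeat constructor; simpl; try lra; try lia.
    intros k Hk. destruct k; [lia | reflexivity].
  - unfold supported in *. simpl choicesG.
    assert (IH' := IH ltac:(intros; apply Hp; lia)). clear IH.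
    destruct (Hp (S n) ltac:(lia)) as (Hd & Hs & Hd0 & Hs0).
    specialize (Hv (S n) ltac:(lia)).
    induction IH' as [|[w X] l [Hw HX] _ IHl]; [constructor|].
    simpl in Hw, HX.
    simpl flat_map. constructor; [|constructor; [|exact IHl]]; simpl.
    + split; [apply Rmult_le_pos; assumption|]. intros Hpos.
      assert (Hw' : 0 < w) by (destruct Hw as [Hw|Hw]; [exact Hw | subst; lra]).
      destruct (HX Hw') as (X0 & X1 & X2). split; [|split].
      * rewrite upd_neq by lia. exact X0.
      * intros k Hk. destruct (Nat.eq_dec k (S n)) as [->|Hne].
        -- left. rewrite upd_eq. split; [reflexivity|].
           assert (eta (S n) <> 0%Z) by (intros E; rewrite (Hd0 E) in Hpos; lra). lia.
        -- rewrite upd_neq by lia. apply X1; lia.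
      * intros k Hk. rewrite upd_neq by lia. apply X2; lia.
    + split; [apply Rmult_le_pos; assumption|]. intros Hpos.
      assert (Hw' : 0 < w) by (destruct Hw as [Hw|Hw]; [exact Hw | subst; lra]).
      destruct (HX Hw') as (X0 & X1 & X2). split; [|split].
      * rewrite upd_neq by lia. exact X0.
      * intros k Hk. destruct (Nat.eq_dec k (S n)) as [->|Hne].
        -- right. rewrite upd_eq. split; [reflexivity|].
           assert (eta (S n) <> (Z.of_nat J + 1)%Z) by (intros E; rewrite (Hs0 E) in Hpos; lra). lia.
        -- rewrite upd_neq by lia. apply X1; lia.
      * intros k Hk. rewrite upd_neq by lia. apply X2; lia.
Qed.

Definition feasible (J t : nat) (eta X : config) : Prop :=
    X O = Z.of_nat J /\
    (forall k, (1 <= k <= S t)%nat -> (X k = eta k - 1 /\ 1 <= eta k)%Z \/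
                                   (X k = eta k /\ eta k <= Z.of_nat J)%Z) /\
    (forall k, (S t < k)%nat -> X k = eta k).

Lemma supported_choices_valid J P Q t eta :
  admissible J P Q -> valid J t eta ->
  supported (choicesG J (P (S t) eta) (Q (S t) eta) eta (S t)) (feasible J t eta).
Proof.
  intros HA HV. apply supported_choicesG.
  - intros k Hk. destruct (HA t eta k HV ltac:(lia)) as (? & ? & _ & ? & ?). auto.
  - apply HV.
Qed.

(** Every [X k] lies in [[0, J]] and every remainder [eta k - X k] is 0 or 1, so the new occupation
    numbers are at most [J + 1]. Site [S t] was empty before the step, so nothing passes it and the
    total grows by exactly the [J] entering particles. *)
Lemma valid_newconf J t eta X :
  valid J t eta -> feasible J t eta X -> valid J (S t) (newconf eta X).
Proof.
  intros (Hb & H0 & Hs) (X0 & X1 & X2).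
  assert (XS : X (S t) = 0%Z).
  { pose proof (H0 (S t) ltac:(lia)). destruct (X1 (S t) ltac:(lia)) as [[? ?]|[? ?]]; lia. }
  assert (Xb : forall k, (0 <= X k <= Z.of_nat J)%Z).
  { intros k. destruct k as [|k]; [lia|].
    destruct (Nat.le_gt_cases (S k) (S t)) as [Hk|Hk].
    - specialize (Hb (S k) ltac:(lia)). destruct (X1 (S k) ltac:(lia)) as [[? ?]|[? ?]]; lia.
    - rewrite X2 by lia. rewrite H0 by lia. lia. }
  split; [|split].
  - intros [|k] Hk; [lia|]. cbn [newconf].
    specialize (Hb (S k) ltac:(lia)). pose proof (Xb k).
    destruct (Nat.le_gt_cases (S k) (S t)) as [Hk'|Hk'].
    + destruct (X1 (S k) ltac:(lia)) as [[? ?]|[? ?]]; lia.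
    + rewrite X2 by lia. lia.
  - intros [|k] Hk; [lia|]. cbn [newconf].
    rewrite X2 by lia. destruct (Nat.eq_dec k (S t)) as [->|Hne].
    + rewrite XS. lia.
    + rewrite (X2 k), (H0 k) by lia. lia.
  - rewrite psum_newconf, X0, XS, psum_S, (H0 (S t)), Hs, <- INR_IZR_INZ, S_INR by lia. ring.
Qed.

Lemma supported_lawG J P Q t : admissible J P Q -> supported (lawG J P Q t) (valid J t).
Proof.
  intros HA. induction t as [|t IH].
  - repeat constructor; simpl; try lra; try lia. unfold psum; simpl; ring.
  - unfold supported in *. cbn [lawG].
    induction IH as [|[w eta] l [Hw HX] _ IHl]; [constructor|].
    cbn [flat_map]. apply Forall_app. split; [|exact IHl]. simpl in Hw, HX.
    apply Forall_map, Forall_forall. intros [w' X] Hin. simpl.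
    destruct Hw as [Hw|Hw].
    + pose proof (supported_choices_valid J P Q t eta HA (HX Hw)) as G.
      unfold supported in G. rewrite Forall_forall in G. specialize (G _ Hin). simpl in G.
      destruct G as [Hw' G]. split; [apply Rmult_le_pos; lra|]. intros Hpos. apply valid_newconf; [auto|].
      apply G. destruct Hw' as [|Hw']; [assumption|]. subst. lra.
    + subst. split; [|intros]; lra.
Qed.

Lemma wsum_choicesG_one J pd ps eta n :
  (forall i, (1 <= i <= n)%nat -> pd i + ps i = 1) ->
  wsum (choicesG J pd ps eta n) (fun _ => 1) = 1.
Proof.
  intros H. rewrite (choicesG_truncate J pd ps eta 0 n).
  - simpl. ring.
  - intros X Y _. reflexivity.
  - lia.
  - intros; apply H; lia.
Qed.

Lemma lawG_step J P Q t g G : admissible J P Q ->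
  (forall eta, valid J t eta ->
    wsum (choicesG J (P (S t) eta) (Q (S t) eta) eta (S t)) (fun X => g (newconf eta X)) = G eta) ->
  wsum (lawG J P Q (S t)) g = wsum (lawG J P Q t) G.
Proof.
  intros HA H. rewrite wsum_lawG_S. eapply wsum_ext_supp; [apply supported_lawG; exact HA|].
  exact H.
Qed.

Lemma wsum_lawG_one J P Q t : admissible J P Q -> wsum (lawG J P Q t) (fun _ => 1) = 1.
Proof.
  intros HA. induction t as [|t IH]; [simpl; ring|].
  rewrite (lawG_step J P Q t _ (fun _ => 1) HA); [exact IH|].
  intros eta HV. apply wsum_choicesG_one. intros i Hi. apply (HA t eta i HV); lia.
Qed.

(** * Duality *)

(* A factor [fac h a c] evaluates one dual particle having [c] dual particles
   at or to the right of it. *)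
Fixpoint cluster (fac : R -> R -> nat -> R) (h a : R) (c k : nat) : R :=
  match k with O => 1 | S k' => fac h a c * cluster fac h a (S c) k' end.

Fixpoint dualfun (fac : R -> R -> nat -> R) (J t c : nat) (xs : list nat) (eta : config) : R :=
  match xs with
  | [] => 1
  | x :: xs' => fac (hh J t eta x) (aa J eta x) c * dualfun fac J t (S c) xs' eta
  end.

Fixpoint decr (l : list nat) : Prop :=
  match l with [] => True | x :: r => (forall y, In y r -> (y <= x)%nat) /\ decr r end.

(* Clusters [(x, k)] stand for [k + 1] dual particles at [x]. *)
Definition expand (cls : list (nat * nat)) : list nat :=
  flat_map (fun p => repeat (fst p) (S (snd p))) cls.

Fixpoint sdecr (cls : list (nat * nat)) : Prop :=
  match cls with
  | [] => True
  | p :: r => (forall q, In q r -> (fst q < fst p)%nat) /\ sdecr r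
  end.

Lemma dualfun_app fac J t c xs ys eta :
  dualfun fac J t c (xs ++ ys) eta =
  dualfun fac J t c xs eta * dualfun fac J t (c + length xs) ys eta.
Proof.
  revert c. induction xs as [|x xs IH]; intros c; simpl.
  - rewrite Nat.add_0_r. ring.
  - rewrite IH. replace (S c + length xs)%nat with (c + S (length xs))%nat by lia. ring.
Qed.

Lemma dualfun_repeat fac J t c x k eta :
  dualfun fac J t c (repeat x k) eta = cluster fac (hh J t eta x) (aa J eta x) c k.
Proof. revert c. induction k as [|k IH]; intros c; simpl; [reflexivity | now rewrite IH]. Qed.

Lemma decr_app l1 l2 :
  decr (l1 ++ l2) <-> decr l1 /\ decr l2 /\ (forall x y, In x l1 -> In y l2 -> (y <= x)%nat).
Proof.
  induction l1 as [|x l1 IH]; simpl.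
  - intuition.
  - rewrite IH. split.
    + intros (H & H1 & H2 & H3). repeat split; auto.
      * intros y Hy. apply H, in_or_app. auto.
      * intros z y [<-|Hz] Hy; [apply H, in_or_app; auto | eauto].
    + intros ((H & H1) & H2 & H3). repeat split; auto.
      intros y Hy. apply in_app_or in Hy as [Hy|Hy]; eauto.
Qed.

Lemma decr_repeat x k : decr (repeat x k).
Proof.
  induction k as [|k IH]; simpl; [exact I|]. split; [|exact IH].
  intros y Hy. apply repeat_spec in Hy. lia.
Qed.

(** Dual particles on one site depend on the same variable [X] and must be averaged together; only
    distinct sites are independent. *)
Lemma decr_clusters ys : decr ys -> exists cls, sdecr cls /\ ys = expand cls.
Proof.
  induction ys as [|y ys IH]; intros H.
  - exists []. split; [exact I | reflexivity].
  - destruct H as [Hy H]. destruct (IH H) as (cls & Hs & E).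
    destruct cls as [|[x k] cls].
    + exists [(y, 0%nat)]. subst ys. repeat split. intros q [].
    + assert (x <= y)%nat by (apply Hy; rewrite E; left; reflexivity).
      destruct Hs as [Hx Hs]. destruct (Nat.eq_dec x y) as [->|Hne].
      * exists ((y, S k) :: cls). split; [split; assumption|]. rewrite E. reflexivity.
      * exists ((y, 0%nat) :: (x, k) :: cls). split; [|rewrite E; reflexivity].
        split; [|split; assumption]. simpl in *.
        intros q [<-|Hq]; simpl; [lia|]. specialize (Hx q Hq). lia.
Qed.

(** Values at [S x] after a step are expressed through values at [x] before it, whereas position 0
    has no left neighbour. Boundary particles are therefore split off; by monotonicity they come
    last. *)
Lemma decr_split_zero xs : decr xs ->
  exists ys j, decr ys /\ xs = map S ys ++ repeat O j.
Proof.
  induction xs as [|x xs IH]; intros H.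
  - exists [], O. split; [exact I | reflexivity].
  - destruct H as [Hx H]. destruct (IH H) as (ys & j & Hd & E).
    destruct x as [|x].
    + exists [], (S j). split; [exact I|]. destruct ys as [|y ys].
      * simpl in *. now rewrite E.
      * exfalso. specialize (Hx (S y)). rewrite E in Hx. simpl in Hx. specialize (Hx (or_introl eq_refl)). lia.
    + exists (x :: ys), j. split; [|rewrite E; reflexivity]. split; [|exact Hd].
      intros y Hy. specialize (Hx (S y)). rewrite E in Hx.
      assert (S y <= S x)%nat; [|lia]. apply Hx, in_or_app. left. now apply in_map.
Qed.

(** The left side is the one-step mean of a cluster of [k + 1] particles moved from [x] to [S x]. On
    the right the particle of lowest rank [c] may lag at [S x], which keeps the list of positions
    decreasing. The weights involve neither [fac] nor the jump probabilities; this is what makes two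
    processes comparable. *)
Definition dualizable (J : nat) (P Q : nat -> config -> nat -> R) (fac : R -> R -> nat -> R) :=
  forall t eta x c k, valid J t eta ->
    let h := hh J t eta x in let a := aa J eta x in
    P (S t) eta (S x) * cluster fac (h - 1) a c (S k)
    + Q (S t) eta (S x) * cluster fac h (a + 1) c (S k)
    = (1 - INR (S k) / (INR J + 1)) * cluster fac h a c (S k)
      + INR (S k) / (INR J + 1)
        * (fac (hh J t eta (S x)) (aa J eta (S x)) c * cluster fac h a (S c) k).

(** The product over clusters of the right sides of [dualizable]: the conditional mean of the dual
    function after one step. *)
Fixpoint dualstep (fac : R -> R -> nat -> R) (J t c : nat) (cls : list (nat * nat))
    (eta : config) : R :=
  match cls with
  | [] => 1
  | (x, k) :: r =>
      let h := hh J t eta x in let a := aa J eta x in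
      ((1 - INR (S k) / (INR J + 1)) * cluster fac h a c (S k)
      + INR (S k) / (INR J + 1)
        * (fac (hh J t eta (S x)) (aa J eta (S x)) c * cluster fac h a (S c) k))
      * dualstep fac J t (c + S k) r eta
  end.

(** The dual function after one step, written through the old heights and gaps and the outcome [X],
    before averaging. [B] is 1 if the site keeps a remainder smaller or larger by one, as recorded
    by [eta (S x) - X (S x)]. *)
Fixpoint dualmove (fac : R -> R -> nat -> R) (J t : nat) (eta : config) (c : nat)
    (cls : list (nat * nat)) (X : config) : R :=
  match cls with
  | [] => 1
  | (x, k) :: r =>
      let B v := IZR (eta (S x)) - IZR v in
      cluster fac (hh J t eta x - B (X (S x))) (aa J eta x + 1 - B (X (S x))) c (S k)
      * dualmove fac J t eta (c + S k) r X
  end.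

Lemma hh_newconf J t eta X x : X O = Z.of_nat J ->
  hh J (S t) (newconf eta X) (S x) = hh J t eta x - (IZR (eta (S x)) - IZR (X (S x))).
Proof.
  intros H. unfold hh. rewrite psum_newconf, H, psum_S, <- INR_IZR_INZ, S_INR. ring.
Qed.

Lemma aa_newconf J eta X x : X O = Z.of_nat J ->
  aa J (newconf eta X) (S x) = aa J eta x + 1 - (IZR (eta (S x)) - IZR (X (S x))).
Proof.
  intros H. unfold aa. rewrite psum_newconf, H, psum_S, <- INR_IZR_INZ, S_INR. ring.
Qed.

Lemma dualfun_newconf fac J t c cls eta X : X O = Z.of_nat J ->
  dualfun fac J (S t) c (map S (expand cls)) (newconf eta X) = dualmove fac J t eta c cls X.
Proof.
  intros H. revert c. induction cls as [|[x k] cls IH]; intros c; [reflexivity|].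
  change (expand ((x, k) :: cls)) with (repeat x (S k) ++ expand cls).
  rewrite map_app, map_repeat, dualfun_app, dualfun_repeat, repeat_length, IH.
  rewrite hh_newconf, aa_newconf by exact H. reflexivity.
Qed.

Lemma dualmove_depends fac J t eta c cls n :
  (forall q, In q cls -> (fst q < n)%nat) ->
  depends_upto n (dualmove fac J t eta c cls).
Proof.
  revert c. induction cls as [|[x k] cls IH]; intros c Hq X Y HXY; [reflexivity|].
  cbn [dualmove]. cbv zeta. rewrite (HXY (S x)).
  - f_equal. apply IH; [|exact HXY]. intros q Hin. apply Hq. now right.
  - specialize (Hq (x, k) (or_introl eq_refl)). simpl in Hq. lia.
Qed.

(** The first cluster is the rightmost one, and its variable [X (S x)] is independent of those of
    all clusters to its left. Peeling it off leaves the same problem on the first [x]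
    coordinates. *)
Lemma choices_dualmove J P Q fac t eta c cls n :
  admissible J P Q -> dualizable J P Q fac -> valid J t eta ->
  sdecr cls -> (forall q, In q cls -> (fst q < n)%nat) ->
  wsum (choicesG J (P (S t) eta) (Q (S t) eta) eta n) (dualmove fac J t eta c cls)
  = dualstep fac J t c cls eta.
Proof.
  intros HA HD HV. revert c n. induction cls as [|[x k] cls IH]; intros c n Hs Hn.
  - apply wsum_choicesG_one. intros i Hi. apply (HA t eta i HV); lia.
  - destruct Hs as [Hx Hs]. simpl in Hx.
    cbn [dualmove dualstep]. cbv zeta.
    rewrite (choicesG_peel J (P (S t) eta) (Q (S t) eta) eta x n
      (fun v => cluster fac (hh J t eta x - (IZR (eta (S x)) - IZR v))
                (aa J eta x + 1 - (IZR (eta (S x)) - IZR v)) c (S k))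
      (dualmove fac J t eta (c + S k) cls)).
    + rewrite IH by (try exact Hs; intros q Hq; apply (Hx q Hq)).
      f_equal. rewrite <- (HD t eta x c k HV). rewrite minus_IZR.
      replace (hh J t eta x - (IZR (eta (S x)) - (IZR (eta (S x)) - 1))) with (hh J t eta x - 1) by ring.
      replace (hh J t eta x - (IZR (eta (S x)) - IZR (eta (S x)))) with (hh J t eta x) by ring.
      replace (aa J eta x + 1 - (IZR (eta (S x)) - (IZR (eta (S x)) - 1))) with (aa J eta x) by ring.
      replace (aa J eta x + 1 - (IZR (eta (S x)) - IZR (eta (S x)))) with (aa J eta x + 1) by ring.
      reflexivity.
    + apply dualmove_depends. exact Hx.
    + apply (Hn (x, k)). now left.
    + intros i Hi. apply (HA t eta i HV); lia.
Qed.

Lemma lawG_dualstep J P Q fac t cls :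
  admissible J P Q -> dualizable J P Q fac ->
  sdecr cls -> (forall q, In q cls -> (fst q < S t)%nat) ->
  wsum (lawG J P Q (S t)) (dualfun fac J (S t) 0 (map S (expand cls)))
  = wsum (lawG J P Q t) (dualstep fac J t 0 cls).
Proof.
  intros HA HD Hs Hn. apply lawG_step; [exact HA|]. intros eta HV.
  rewrite <- (choices_dualmove J P Q fac t eta 0 cls (S t)); try assumption.
  eapply wsum_ext_supp; [apply supported_choices_valid; assumption|].
  intros X HX. apply dualfun_newconf. apply HX.
Qed.

(* Both one-step expectations are the same combination of dual functions; the clusters
   already expanded form [ys]. *)
Lemma dualstep_transfer J P1 Q1 fac1 P2 Q2 fac2 t (kappa : nat -> R) :
  (forall xs, decr xs ->
     wsum (lawG J P1 Q1 t) (dualfun fac1 J t 0 xs)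
     = kappa (length xs) * wsum (lawG J P2 Q2 t) (dualfun fac2 J t 0 xs)) ->
  forall cls ys, sdecr cls -> decr ys ->
    (forall q y, In q cls -> In y ys -> (fst q < y)%nat) ->
    wsum (lawG J P1 Q1 t) (fun eta => dualfun fac1 J t 0 ys eta * dualstep fac1 J t (length ys) cls eta)
    = kappa (length (ys ++ expand cls)) *
      wsum (lawG J P2 Q2 t) (fun eta => dualfun fac2 J t 0 ys eta * dualstep fac2 J t (length ys) cls eta).
Proof.
  intros IH. induction cls as [|[x k] cls IHc]; intros ys Hs Hd Hlt.
  - unfold expand. simpl. rewrite app_nil_r.
    rewrite (wsum_ext (lawG J P1 Q1 t) _ (dualfun fac1 J t 0 ys)) by (intros; ring).
    rewrite (wsum_ext (lawG J P2 Q2 t) _ (dualfun fac2 J t 0 ys)) by (intros; ring).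
    apply IH, Hd.
  - destruct Hs as [Hx Hs]. simpl in Hx.
    (* [ys1] keeps the cluster together, [ys2] lets its leading particle lag at [S x]. Since
       everything in [ys] is strictly right of [x], both lists are still decreasing. *)
    set (ys1 := ys ++ repeat x (S k)). set (ys2 := ys ++ S x :: repeat x k).
    set (al := 1 - INR (S k) / (INR J + 1)). set (be := INR (S k) / (INR J + 1)).
    assert (L1 : length ys1 = (length ys + S k)%nat)
      by (unfold ys1; rewrite length_app, repeat_length; reflexivity).
    assert (L2 : length ys2 = (length ys + S k)%nat)
      by (unfold ys2; rewrite length_app; simpl; rewrite repeat_length; reflexivity).
    assert (Hexp : forall P Q fac,
      wsum (lawG J P Q t) (fun eta => dualfun fac J t 0 ys eta * dualstep fac J t (length ys) ((x, k) :: cls) eta)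
      = al * wsum (lawG J P Q t) (fun eta => dualfun fac J t 0 ys1 eta * dualstep fac J t (length ys1) cls eta)
      + be * wsum (lawG J P Q t) (fun eta => dualfun fac J t 0 ys2 eta * dualstep fac J t (length ys2) cls eta)).
    { intros P Q fac. rewrite <- !wsum_scal, <- wsum_plus. apply wsum_ext. intros eta.
      rewrite L1, L2. unfold ys1, ys2. rewrite !dualfun_app, dualfun_repeat.
      cbn [dualfun dualstep]. rewrite dualfun_repeat. fold al be. simpl Nat.add. ring. }
    rewrite !Hexp.
    assert (Hys : forall y, In y ys -> (x < y)%nat) by (intros; apply (Hlt (x, k)); [now left | assumption]).
    rewrite (IHc ys1), (IHc ys2).
    + replace (length (ys ++ expand ((x, k) :: cls))) with (length (ys1 ++ expand cls)).
      replace (length (ys2 ++ expand cls)) with (length (ys1 ++ expand cls)).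
      ring.
      * rewrite !length_app, L1, L2. reflexivity.
      * unfold ys1. rewrite <- app_assoc. reflexivity.
    + exact Hs.
    + unfold ys2. apply decr_app. split; [exact Hd|]. split.
      * split; [|apply decr_repeat]. intros y Hy. apply repeat_spec in Hy. lia.
      * intros z y Hz [<-|Hy]; [apply Hys in Hz; lia|]. apply repeat_spec in Hy. apply Hys in Hz. lia.
    + intros q y Hq Hy. unfold ys2 in Hy. specialize (Hx q Hq).
      apply in_app_or in Hy as [Hy|[<-|Hy]].
      * apply Hys in Hy. lia.
      * lia.
      * apply repeat_spec in Hy. lia.
    + exact Hs.
    + unfold ys1. apply decr_app. split; [exact Hd|]. split; [apply decr_repeat|].
      intros z y Hz Hy. apply repeat_spec in Hy. apply Hys in Hz. lia.
    + intros q y Hq Hy. unfold ys1 in Hy. specialize (Hx q Hq).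
      apply in_app_or in Hy as [Hy|Hy].
      * apply Hys in Hy. lia.
      * apply repeat_spec in Hy. lia.
Qed.

Lemma poch_add g n j : poch g (n + j) = poch g n * poch (g + INR n) j.
Proof.
  induction j as [|j IH]; [rewrite Nat.add_0_r; simpl; ring|].
  rewrite Nat.add_succ_r. simpl. rewrite IH, plus_INR. ring.
Qed.

Lemma poch_shift g j : poch g (S j) = g * poch (g + 1) j.
Proof.
  change (S j) with (1 + j)%nat. rewrite poch_add. simpl. rewrite Rplus_0_r. ring.
Qed.

Lemma cluster_left fac1 fac2 g h c k :
  (forall c, fac1 h 0 c = (g + INR c) * fac2 h 0 c) ->
  cluster fac1 h 0 c k = poch (g + INR c) k * cluster fac2 h 0 c k.
Proof.
  intros H. revert c. induction k as [|k IH]; intros c; [simpl; ring|].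
  rewrite poch_shift. cbn [cluster]. rewrite H, IH, S_INR, Rplus_assoc. ring.
Qed.

(** The induction on time covers all decreasing lists at once, because a step turns one list into a
    combination of lists of the same length. Boundary particles contribute the remaining part of the
    Pochhammer symbol through [poch_add]. *)
Theorem dual_comparison J g P1 Q1 fac1 P2 Q2 fac2 :
  admissible J P1 Q1 -> admissible J P2 Q2 ->
  dualizable J P1 Q1 fac1 -> dualizable J P2 Q2 fac2 ->
  (forall a, fac1 0 a 0%nat = 0) -> (forall a, fac2 0 a 0%nat = 0) ->
  (forall h c, fac1 h 0 c = (g + INR c) * fac2 h 0 c) ->
  forall t xs, decr xs ->
    wsum (lawG J P1 Q1 t) (dualfun fac1 J t 0 xs)
    = poch g (length xs) * wsum (lawG J P2 Q2 t) (dualfun fac2 J t 0 xs).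
Proof.
  intros HA1 HA2 HD1 HD2 Hz1 Hz2 Hl.
  (* The first particle has rank 0, so its factor vanishes with the height beyond the occupied
     sites. This also starts the induction at time 0. *)
  assert (Hzero : forall P Q fac t x xs, admissible J P Q -> (forall a, fac 0 a 0%nat = 0) ->
    (t <= x)%nat -> wsum (lawG J P Q t) (dualfun fac J t 0 (x :: xs)) = 0).
  { intros P Q fac t x xs HA Hz Hx. rewrite <- (Rmult_0_l (wsum (lawG J P Q t) (fun _ => 1))), <- wsum_scal.
    eapply wsum_ext_supp; [apply supported_lawG; exact HA|]. intros eta HV.
    cbn [dualfun]. rewrite (hh_out J t eta x HV Hx), Hz. ring. }
  induction t as [|t IH]; intros xs Hd.
  - destruct xs as [|x xs]; [simpl; ring|].
    rewrite !Hzero by (auto; lia). ring.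
  - destruct (decr_split_zero xs Hd) as (ys & j & Hys & ->).
    assert (Hbig : (exists x r, ys = x :: r /\ (t < x)%nat) \/ (forall y, In y ys -> (y <= t)%nat)).
    { destruct ys as [|y ys]; [right; intros ? []|].
      destruct (Nat.le_gt_cases y t) as [Hy|Hy].
      - right. destruct Hys as [Hle _]. intros z [<-|Hz]; [assumption|]. specialize (Hle z Hz). lia.
      - left. exists y, ys. auto. }
    destruct Hbig as [(x & r & -> & Hx)|Hle].
    { simpl map. simpl app. rewrite !Hzero by (auto; lia). ring. }
    (* At position 0 the height is [J (t + 1)] and the gap is 0, both deterministic, so boundary
       particles factor out; their ranks start at [length ys]. *)
    assert (Hdet : forall P Q fac,
      wsum (lawG J P Q (S t)) (dualfun fac J (S t) 0 (map S ys ++ repeat O j))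
      = cluster fac (INR J * INR (S t)) 0 (length ys) j
        * wsum (lawG J P Q (S t)) (dualfun fac J (S t) 0 (map S ys))).
    { intros P Q fac. rewrite <- wsum_scal. apply wsum_ext. intros eta.
      rewrite dualfun_app, dualfun_repeat, length_map. unfold hh, aa, psum. simpl sumR.
      simpl (INR 0). simpl Nat.add.
      replace (INR J * INR (S t) - 0) with (INR J * INR (S t)) by ring.
      replace ((INR J + 1) * 0 - 0) with 0 by ring. ring. }
    rewrite !Hdet.
    destruct (decr_clusters ys Hys) as (cls & Hs & ->).
    assert (Hin : forall q, In q cls -> (fst q < S t)%nat).
    { intros [x k] Hq. simpl. assert (x <= t)%nat; [|lia]. apply Hle.
      unfold expand. apply in_flat_map. exists (x, k). split; [assumption|]. left. reflexivity. }
    rewrite !lawG_dualstep by assumption.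
    assert (E := dualstep_transfer J P1 Q1 fac1 P2 Q2 fac2 t (poch g) IH cls [] Hs I
                   ltac:(intros ? ? _ [])).
    simpl in E.
    rewrite (wsum_ext _ (dualstep fac1 J t 0 cls) (fun eta => 1 * dualstep fac1 J t 0 cls eta)) by (intros; ring).
    rewrite (wsum_ext _ (dualstep fac2 J t 0 cls) (fun eta => 1 * dualstep fac2 J t 0 cls eta)) by (intros; ring).
    rewrite E, length_app, length_map, repeat_length, poch_add.
    rewrite (cluster_left fac1 fac2 g) by (intros; apply Hl). ring.
Qed.

(** * The two processes *)

(** The falling factorial [z (z - 1) ... (z - k + 1)], written as a cluster to match the dual
    functions of the limiting process. *)
Definition ffall (z : R) (k : nat) : R := cluster (fun h _ c => h - INR c) z 0 0 k.

Definition facD (g h a : R) (c : nat) : R := (h - INR c) * (a + g + INR c).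
Definition facI (h a : R) (c : nat) : R := h - INR c.

Definition Pinf (J : nat) (B : nat) (eta : config) (k : nat) : R := IZR (eta k) / (INR J + 1).
Definition Qinf (J : nat) (B : nat) (eta : config) (k : nat) : R :=
  (INR J + 1 - IZR (eta k)) / (INR J + 1).

Lemma cluster_facI h a c k :
  cluster facI (h - 1) a c (S k) = cluster facI h a (S c) k * (h - 1 - INR c - INR k) /\
  cluster facI h (a + 1) c (S k) = (h - INR c) * cluster facI h a (S c) k.
Proof.
  split.
  - revert c. induction k as [|k IH]; intros c.
    + unfold facI. simpl. ring.
    + cbn [cluster] in *. rewrite IH. unfold facI. rewrite !S_INR. ring.
  - cbn [cluster]. f_equal. generalize (S c). induction k as [|k IH]; intros c'; [reflexivity|].
    cbn [cluster]. now rewrite IH.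
Qed.

(** Lowering [h] drops the first factor of the falling part and appends a new last one; raising [a]
    does the same to the rising part. Both results share the cluster of ranks from [S c], which
    cancels in the duality relation. *)
Lemma cluster_facD g h a c k :
  cluster (facD g) (h - 1) a c (S k) =
    (h - 1 - INR c - INR k) * (a + g + INR c) * cluster (facD g) h a (S c) k /\
  cluster (facD g) h (a + 1) c (S k) =
    (h - INR c) * (a + g + INR c + 1 + INR k) * cluster (facD g) h a (S c) k.
Proof.
  split; revert c; induction k as [|k IH]; intros c.
  - unfold facD. simpl. ring.
  - cbn [cluster] in *. rewrite IH. unfold facD. rewrite !S_INR. ring.
  - unfold facD. simpl. ring.
  - cbn [cluster] in *. rewrite IH. unfold facD. rewrite !S_INR. ring.
Qed.

Lemma J1_pos J : 0 < INR J + 1.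
Proof. pose proof (pos_INR J). lra. Qed.

Lemma dualizable_inf J : dualizable J (Pinf J) (Qinf J) facI.
Proof.
  intros t eta x c k HV. cbv zeta. unfold Pinf, Qinf.
  destruct (cluster_facI (hh J t eta x) (aa J eta x) c k) as [-> ->].
  cbn [cluster]. rewrite hh_S, aa_S. unfold facI.
  rewrite S_INR. pose proof (J1_pos J). field. lra.
Qed.

Lemma hgt_hh J t eta B x : valid J t eta -> (t <= B)%nat ->
  hgt B eta (Z.of_nat (S x)) = hh J t eta x.
Proof.
  intros HV HB. unfold hgt.
  assert (G : forall n, sumR (fun j => if (Z.of_nat (S x) <=? Z.of_nat j)%Z then IZR (eta j) else 0) n
      = if Nat.leb n x then 0 else psum eta n - psum eta x).
  { induction n as [|n IH]; [reflexivity|].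
    cbn [sumR]. rewrite IH. clear IH.
    destruct (Nat.leb_spec n x); destruct (Nat.leb_spec (S n) x);
      destruct (Z.leb_spec (Z.of_nat (S x)) (Z.of_nat (S n))); try lia; try ring.
    - assert (n = x) by lia. subst. rewrite psum_S. ring.
    - rewrite psum_S. ring. }
  rewrite G. destruct (Nat.leb_spec B x) as [H|H].
  - rewrite (hh_out J t) by (auto; lia). reflexivity.
  - rewrite (psum_stable J t eta B HV HB). reflexivity.
Qed.

Lemma agap_aa J eta x : agap J eta (S x) = aa J eta x.
Proof.
  unfold agap, aa. replace (S x - 1)%nat with x by lia.
  induction x as [|x IH]; [unfold psum; simpl; ring|].
  cbn [sumR]. rewrite IH, psum_S, S_INR. ring.
Qed.

Lemma Ups_eq J g t eta x : valid J t eta ->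
  Ups J g (S t) eta (S x) = g + hh J t eta x + aa J eta x.
Proof.
  intros HV. unfold Ups. rewrite (hgt_hh J t) by (auto; lia). now rewrite agap_aa.
Qed.

Lemma Ups_ge J g t eta x : valid J t eta -> g <= Ups J g (S t) eta (S x).
Proof.
  intros HV. rewrite Ups_eq by assumption.
  pose proof (hh_nonneg J t eta x HV). pose proof (aa_nonneg J t eta x HV). lra.
Qed.

(** With the common cluster removed, the correction in the jump probabilities multiplies
    [(h - c) + (a + g + c)]. This sum equals [Ups] whatever the rank [c], so the denominator cancels
    and an identity between polynomials remains. *)
Lemma dualizable_dyn J g : 0 < g -> dualizable J (pdown J g) (pstay J g) (facD g).
Proof.
  intros Hg t eta x c k HV. cbv zeta. unfold pdown, pstay.
  pose proof (Ups_ge J g t eta x HV) as HU. rewrite Ups_eq in * by assumption.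
  destruct (cluster_facD g (hh J t eta x) (aa J eta x) c k) as [-> ->].
  cbn [cluster]. rewrite hh_S, aa_S. unfold facD.
  rewrite S_INR. pose proof (J1_pos J). field. lra.
Qed.

Lemma admissible_inf J : admissible J (Pinf J) (Qinf J).
Proof.
  intros t eta k HV Hk. unfold Pinf, Qinf. pose proof (J1_pos J).
  pose proof (valid_IZR J t eta k HV Hk). repeat split.
  - apply Rdiv_le_0_compat; lra.
  - apply Rdiv_le_0_compat; lra.
  - field. lra.
  - intros ->. unfold Rdiv. ring.
  - intros ->. rewrite plus_IZR, <- INR_IZR_INZ. unfold Rdiv. ring.
Qed.

(** The occupation number is at most [J + 1 < g <= Ups], hence [1 - e / Ups] is nonnegative: this is
    where the lower bound on [g] enters. *)
Lemma admissible_dyn J g : INR J + 1 < g -> admissible J (pdown J g) (pstay J g).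
Proof.
  intros Hg t eta k HV Hk. unfold pdown, pstay. pose proof (J1_pos J).
  pose proof (valid_IZR J t eta k HV Hk). destruct k as [|x]; [lia|].
  pose proof (Ups_ge J g t eta x HV). set (U := Ups _ _ _ _ _) in *.
  set (e := IZR (eta (S x))) in *. repeat split.
  - apply Rmult_le_pos; [apply Rdiv_le_0_compat; lra|].
    assert (0 <= (INR J + 1 - e) / U) by (apply Rdiv_le_0_compat; lra). lra.
  - apply Rmult_le_pos; [apply Rdiv_le_0_compat; lra|].
    assert (e / U <= 1) by (apply Rle_div_l; lra). lra.
  - field. lra.
  - unfold e. intros ->. unfold Rdiv. ring.
  - unfold e. intros ->. rewrite plus_IZR, <- INR_IZR_INZ. unfold Rdiv. ring.
Qed.

(** The duality comparison with all [m] dual particles at the single position [k]. *)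
Theorem moment_comparison J g t k m : INR J + 1 < g ->
  wsum (law J g t) (fun eta => cluster (facD g) (hh J t eta k) (aa J eta k) 0 m)
  = poch g m * wsum (lawG J (Pinf J) (Qinf J) t) (fun eta => ffall (hh J t eta k) m).
Proof.
  intros Hg. pose proof (J1_pos J). rewrite law_lawG.
  pose proof (dual_comparison J g (pdown J g) (pstay J g) (facD g) (Pinf J) (Qinf J) facI
    (admissible_dyn J g Hg) (admissible_inf J) (dualizable_dyn J g ltac:(lra)) (dualizable_inf J)) as G.
  specialize (G ltac:(intros; unfold facD; simpl; ring) ltac:(intros; unfold facI; simpl; ring)
    ltac:(intros; unfold facD, facI; ring) t (repeat k m) (decr_repeat k m)).
  rewrite repeat_length in G.
  rewrite (wsum_ext _ _ (fun eta => cluster (facD g) (hh J t eta k) (aa J eta k) 0 m)) in G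
    by (intros; apply dualfun_repeat).
  rewrite G. f_equal. apply wsum_ext. intros eta. rewrite dualfun_repeat.
  unfold ffall. generalize 0%nat. clear G. induction m as [|m IH]; intros c; [reflexivity|].
  cbn [cluster]. now rewrite IH.
Qed.

(** * Concentration for the limiting process *)

Definition Einf (J t : nat) (g : config -> R) : R := wsum (lawG J (Pinf J) (Qinf J) t) g.

Definition meanh (J t k : nat) : R := Einf J t (fun eta => hh J t eta k).

(** The backward operator of the mean evolution: on average the fraction [J / (J + 1)] of the
    particles at [y] moves on to [S y]. *)
Definition wstep (J : nat) (w : nat -> R) (y : nat) : R :=
  INR J / (INR J + 1) * w (S y) + / (INR J + 1) * w y.

Lemma sumR_newconf w eta X n :
  sumR (fun y => w y * IZR (newconf eta X y)) n
  = w 1%nat * IZR (X O)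
    + sumR (fun y => w y * (IZR (eta y) - IZR (X y)) + w (S y) * IZR (X y)) n
    - w (S n) * IZR (X n).
Proof.
  induction n as [|n IH]; [simpl; ring|].
  cbn [sumR]. rewrite IH. cbn [newconf]. rewrite plus_IZR, minus_IZR. ring.
Qed.

Lemma depends_sumR (g : nat -> Z -> R) n :
  depends_upto n (fun X => sumR (fun y => g y (X y)) n).
Proof. intros X Y H. apply sumR_ext. intros j Hj. rewrite H by lia. reflexivity. Qed.

Lemma choicesG_sum J pd ps eta (g : nat -> Z -> R) n :
  (forall i, (1 <= i <= n)%nat -> pd i + ps i = 1) ->
  wsum (choicesG J pd ps eta n) (fun X => sumR (fun y => g y (X y)) n)
  = sumR (fun y => pd y * g y (eta y - 1)%Z + ps y * g y (eta y)) n.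
Proof.
  induction n as [|n IH]; intros H.
  - simpl. ring.
  - cbn [sumR]. rewrite wsum_plus. f_equal.
    + rewrite (choicesG_truncate J pd ps eta n (S n));
        [| apply depends_sumR | lia | intros; apply H; lia].
      apply IH. intros; apply H; lia.
    + rewrite (wsum_ext _ (fun X : config => g (S n) (X (S n))) (fun X : config => g (S n) (X (S n)) * 1))
        by (intros; ring).
      rewrite (choicesG_peel J pd ps eta n (S n) (g (S n)) (fun _ => 1));
        [| intros ? ? _; reflexivity | lia | exact H].
      rewrite wsum_choicesG_one by (intros; apply H; lia). ring.
Qed.

(** By independence the exponential moment is a product over sites. Nonnegativity is carried along
    so that the sitewise bounds can be multiplied. *)
Lemma choicesG_exp_le J pd ps eta (g : nat -> Z -> R) (G : nat -> R) n :
  (forall i, (1 <= i <= n)%nat -> pd i + ps i = 1 /\ 0 <= pd i /\ 0 <= ps i) ->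
  (forall i, (1 <= i <= n)%nat ->
     pd i * exp (g i (eta i - 1)%Z) + ps i * exp (g i (eta i)) <= exp (G i)) ->
  0 <= wsum (choicesG J pd ps eta n) (fun X => exp (sumR (fun y => g y (X y)) n))
    <= exp (sumR G n).
Proof.
  induction n as [|n IH]; intros H HG.
  - simpl. rewrite exp_0. lra.
  - cbn [sumR].
    rewrite (wsum_ext _ _ (fun X : config => exp (g (S n) (X (S n))) * exp (sumR (fun y => g y (X y)) n)))
      by (intros; rewrite exp_plus; ring).
    rewrite (choicesG_peel J pd ps eta n (S n) (fun v => exp (g (S n) v))).
    + destruct IH as [I1 I2]; [intros; apply H; lia | intros; apply HG; lia |].
      destruct (H (S n) ltac:(lia)) as (_ & Hd & Hs). specialize (HG (S n) ltac:(lia)).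
      pose proof (exp_pos (g (S n) (eta (S n) - 1)%Z)). pose proof (exp_pos (g (S n) (eta (S n)))).
      assert (0 <= pd (S n) * exp (g (S n) (eta (S n) - 1)%Z) + ps (S n) * exp (g (S n) (eta (S n))))
        by (apply Rplus_le_le_0_compat; apply Rmult_le_pos; lra).
      split; [apply Rmult_le_pos; assumption|].
      rewrite exp_plus, Rmult_comm. apply Rmult_le_compat; assumption.
    + intros X Y HXY. f_equal. apply (depends_sumR g n X Y HXY).
    + lia.
    + intros; apply H; lia.
Qed.

Lemma sumR_valid_S J t eta w : valid J t eta ->
  sumR (fun y => w y * IZR (eta y)) (S t) = sumR (fun y => w y * IZR (eta y)) t.
Proof. intros (_ & H0 & _). cbn [sumR]. rewrite H0 by lia. ring. Qed.

Lemma feasible_last J t eta X : valid J t eta -> feasible J t eta X -> X (S t) = 0%Z.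
Proof.
  intros (_ & H0 & _) (_ & HX & _). pose proof (H0 (S t) ltac:(lia)).
  destruct (HX (S t) ltac:(lia)) as [[? ?]|[? ?]]; lia.
Qed.

Lemma Pinf_Qinf J B eta k : Pinf J B eta k + Qinf J B eta k = 1.
Proof. unfold Pinf, Qinf. pose proof (J1_pos J). field. lra. Qed.

Lemma Einf_linear_step J t w :
  Einf J (S t) (fun eta => sumR (fun y => w y * IZR (eta y)) (S t))
  = INR J * w 1%nat + Einf J t (fun eta => sumR (fun y => wstep J w y * IZR (eta y)) t).
Proof.
  unfold Einf.
  rewrite <- (Rmult_1_r (INR J * w 1%nat)),
    <- (wsum_lawG_one J (Pinf J) (Qinf J) t (admissible_inf J)), <- wsum_scal, <- wsum_plus.
  apply lawG_step; [apply admissible_inf|]. intros eta HV.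
  pose (ps := Qinf J (S t) eta). pose (pd := Pinf J (S t) eta).
  rewrite (wsum_ext_supp _ (feasible J t eta) _ (fun X =>
     INR J * w 1%nat * 1
     + sumR (fun y => w y * (IZR (eta y) - IZR (X y)) + w (S y) * IZR (X y)) (S t))).
  - rewrite wsum_plus, wsum_scal. rewrite wsum_choicesG_one by (intros; apply Pinf_Qinf).
    rewrite (choicesG_sum J _ _ eta (fun y v => w y * (IZR (eta y) - IZR v) + w (S y) * IZR v))
      by (intros; apply Pinf_Qinf).
    f_equal. rewrite <- (sumR_valid_S J t eta (wstep J w) HV).
    apply sumR_ext. intros j _. rewrite minus_IZR. unfold wstep, Pinf, Qinf.
    pose proof (J1_pos J). field. lra.
  - apply supported_choices_valid; [apply admissible_inf | exact HV].
  - intros X HX. rewrite sumR_newconf, (feasible_last J t eta X HV HX).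
    destruct HX as (-> & _). rewrite <- INR_IZR_INZ. ring.
Qed.

(** Bernoulli's inequality for [(1 + d / x) ^ (S e)], cleared of denominators; [d] may be
    negative. *)
Lemma bernoulli_shift x d e : 0 < x -> 0 < x + d ->
  x ^ e * (x + INR (S e) * d) <= (x + d) ^ (S e).
Proof.
  intros Hx Hxd. induction e as [|e IH]; [simpl; lra|].
  change ((x + d) ^ S (S e)) with ((x + d) * (x + d) ^ S e).
  apply Rle_trans with ((x + d) * (x ^ e * (x + INR (S e) * d))).
  - rewrite (S_INR (S e)). pose proof (pow_lt x e Hx). pose proof (pos_INR (S e)).
    assert (0 <= x ^ e * (INR (S e) * (d * d))).
    { apply Rmult_le_pos; [lra|]. apply Rmult_le_pos; [lra|]. nra. }
    simpl pow. lra.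
  - apply Rmult_le_compat_l; lra.
Qed.

Lemma exp_INR_ln x e : 0 < x -> exp (INR e * ln x) = x ^ e.
Proof. intros Hx. change (Rpower x (INR e) = x ^ e). now apply Rpower_pow. Qed.

Lemma exp_mono x y : x <= y -> exp x <= exp y.
Proof. intros [H| ->]; [apply Rlt_le, exp_increasing, H | apply Rle_refl]. Qed.

(* Bernoulli's inequality bounds the generating function of one site by a pure power. *)
Lemma site_bound J (z : Z) (w v : R) : 0 <= w -> 0 <= v -> (0 <= z)%Z ->
  IZR z / (INR J + 1) * exp (ln (1 + w) * (IZR z - IZR (z - 1)) + ln (1 + v) * IZR (z - 1))
  + (INR J + 1 - IZR z) / (INR J + 1) * exp (ln (1 + w) * (IZR z - IZR z) + ln (1 + v) * IZR z)
  <= exp (ln (1 + (INR J / (INR J + 1) * v + / (INR J + 1) * w)) * IZR z).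
Proof.
  intros Hw Hv Hz. pose proof (J1_pos J) as HJ.
  destruct (Z_of_nat_complete z Hz) as (e & ->).
  replace (ln (1 + w) * (IZR (Z.of_nat e) - IZR (Z.of_nat e)) + ln (1 + v) * IZR (Z.of_nat e))
    with (INR e * ln (1 + v)) by (rewrite INR_IZR_INZ; ring).
  rewrite (Rmult_comm (ln (1 + (_ + _)))), <- INR_IZR_INZ.
  set (w' := INR J / (INR J + 1) * v + / (INR J + 1) * w).
  assert (Hw' : 0 <= w').
  { unfold w'. pose proof (pos_INR J). apply Rplus_le_le_0_compat; apply Rmult_le_pos; try lra.
    - apply Rdiv_le_0_compat; lra.
    - apply Rlt_le, Rinv_0_lt_compat; lra. }
  rewrite !exp_INR_ln by lra.
  destruct e as [|e].
  - simpl. right. field. lra.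
  - rewrite minus_IZR, <- INR_IZR_INZ.
    replace (ln (1 + w) * (INR (S e) - (INR (S e) - 1)) + ln (1 + v) * (INR (S e) - 1))
      with (ln (1 + w) + INR e * ln (1 + v)) by (rewrite S_INR; ring).
    rewrite exp_plus, exp_ln, exp_INR_ln by lra.
    (* With [e + 1] particles on the site the left side is exactly
       [(1 + v) ^ e * ((1 + v) + (e + 1) d)], and the averaged weight is [v + d]. *)
    set (d := / (INR J + 1) * (w - v)).
    assert (E : w' = v + d).
    { unfold w', d. field. lra. }
    apply Rle_trans with ((1 + v) ^ e * ((1 + v) + INR (S e) * d)).
    + right. unfold d. rewrite <- tech_pow_Rmult. field. lra.
    + replace (1 + w') with (1 + v + d) by (rewrite E; ring).
      apply bernoulli_shift; lra.
Qed.

Lemma wstep_nonneg J w : (forall y, 0 <= w y) -> forall y, 0 <= wstep J w y.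
Proof.
  intros Hw y. unfold wstep. pose proof (J1_pos J). pose proof (pos_INR J).
  apply Rplus_le_le_0_compat; apply Rmult_le_pos; auto.
  - apply Rdiv_le_0_compat; lra.
  - apply Rlt_le, Rinv_0_lt_compat; lra.
Qed.

(* Occupation numbers are dominated, in generating function, by independent Poisson variables. *)
Theorem Einf_exp_le J t w : (forall y, 0 <= w y) ->
  Einf J t (fun eta => exp (sumR (fun y => ln (1 + w y) * IZR (eta y)) t))
  <= exp (Einf J t (fun eta => sumR (fun y => w y * IZR (eta y)) t)).
Proof.
  revert w. induction t as [|t IH]; intros w Hw.
  - unfold Einf. simpl. right. rewrite Rmult_0_r, !Rplus_0_r, exp_0. ring.
  - rewrite Einf_linear_step, exp_plus.
    specialize (IH (wstep J w) (wstep_nonneg J w Hw)).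
    apply Rle_trans with (exp (INR J * ln (1 + w 1%nat)) *
      Einf J t (fun eta => exp (sumR (fun y => ln (1 + wstep J w y) * IZR (eta y)) t))).
    + unfold Einf. rewrite <- wsum_scal, wsum_lawG_S.
      eapply wsum_le_supp; [apply supported_lawG, admissible_inf|]. intros eta HV.
      rewrite <- (sumR_valid_S J t eta (fun y => ln (1 + wstep J w y)) HV).
      rewrite (wsum_ext_supp _ (feasible J t eta) _ (fun X =>
        exp (INR J * ln (1 + w 1%nat)) *
        exp (sumR (fun y => ln (1 + w y) * (IZR (eta y) - IZR (X y)) + ln (1 + w (S y)) * IZR (X y)) (S t)))).
      * rewrite wsum_scal. apply Rmult_le_compat_l; [apply Rlt_le, exp_pos|].
        apply (choicesG_exp_le J _ _ eta
          (fun y v => ln (1 + w y) * (IZR (eta y) - IZR v) + ln (1 + w (S y)) * IZR v)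
          (fun y => ln (1 + wstep J w y) * IZR (eta y)) (S t)).
        -- intros i Hi. destruct (admissible_inf J t eta i HV ltac:(lia)) as (? & ? & ? & _). auto.
        -- intros i Hi. unfold Pinf, Qinf. apply site_bound; try apply Hw. apply HV. lia.
      * apply supported_choices_valid; [apply admissible_inf | exact HV].
      * intros X HX. rewrite (sumR_newconf (fun y => ln (1 + w y))), (feasible_last J t eta X HV HX).
        destruct HX as (-> & _). rewrite <- INR_IZR_INZ, <- exp_plus. f_equal. ring.
    + apply Rmult_le_compat; [apply Rlt_le, exp_pos | | | exact IH].
      * unfold Einf. rewrite <- (Rmult_0_l (wsum (lawG J (Pinf J) (Qinf J) t) (fun _ => 1))), <- wsum_scal.
        eapply wsum_le_supp; [apply supported_lawG, admissible_inf|]. intros eta HV.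
        rewrite Rmult_0_l. apply Rlt_le, exp_pos.
      * apply exp_mono. apply Rmult_le_compat_l; [apply pos_INR|].
        rewrite <- (ln_exp (w 1%nat)) at 2. specialize (Hw 1%nat).
        apply ln_le; [lra|]. apply exp_ineq1_le.
Qed.

Lemma hh_sum J t eta k : valid J t eta ->
  hh J t eta k = sumR (fun y => (if Nat.leb y k then 0 else 1) * IZR (eta y)) t.
Proof.
  intros HV.
  assert (G : forall n, sumR (fun y => (if Nat.leb y k then 0 else 1) * IZR (eta y)) n
     = if Nat.leb n k then 0 else psum eta n - psum eta k).
  { induction n as [|n IH]; [reflexivity|]. cbn [sumR]. rewrite IH.
    destruct (Nat.leb_spec n k); destruct (Nat.leb_spec (S n) k); try lia; rewrite ?psum_S; try ring.
    assert (n = k) by lia. subst. ring. }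
  rewrite G. destruct (Nat.leb_spec t k) as [H|H].
  - now rewrite (hh_out J t).
  - unfold hh. rewrite (psum_stable J t eta t HV) by lia. reflexivity.
Qed.

Lemma Einf_ext J t f g : (forall eta, valid J t eta -> f eta = g eta) -> Einf J t f = Einf J t g.
Proof. apply wsum_ext_supp, supported_lawG, admissible_inf. Qed.

Lemma Einf_le J t f g : (forall eta, valid J t eta -> f eta <= g eta) -> Einf J t f <= Einf J t g.
Proof. apply wsum_le_supp, supported_lawG, admissible_inf. Qed.

Lemma Einf_const J t c : Einf J t (fun _ => c) = c.
Proof.
  unfold Einf. rewrite (wsum_ext _ _ (fun _ => c * 1)) by (intros; ring).
  rewrite wsum_scal, wsum_lawG_one by apply admissible_inf. ring.
Qed.

Lemma Einf_plus J t f g : Einf J t (fun x => f x + g x) = Einf J t f + Einf J t g.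
Proof. apply wsum_plus. Qed.

Lemma Einf_scal J t c f : Einf J t (fun x => c * f x) = c * Einf J t f.
Proof. apply wsum_scal. Qed.

Lemma Einf_exp_h J t k w : 0 <= w ->
  Einf J t (fun eta => exp (ln (1 + w) * hh J t eta k)) <= exp (w * meanh J t k).
Proof.
  intros Hw.
  assert (H := Einf_exp_le J t (fun y => (if Nat.leb y k then 0 else 1) * w)).
  replace (w * meanh J t k) with
    (Einf J t (fun eta => sumR (fun y => (if Nat.leb y k then 0 else 1) * w * IZR (eta y)) t)).
  - erewrite Einf_ext; [apply H|].
    + intros y. destruct (Nat.leb y k); lra.
    + intros eta HV. cbv beta. f_equal. rewrite (hh_sum J t eta k HV).
      clear. induction t as [|n IH]; [simpl; ring|].
      cbn [sumR]. rewrite <- IH. destruct (Nat.leb (S n) k); [|rewrite !Rmult_1_l; ring].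
      rewrite !Rmult_0_l, !Rplus_0_r, ln_1. ring.
  - unfold meanh. rewrite <- Einf_scal. apply Einf_ext. intros eta HV.
    rewrite (hh_sum J t eta k HV). clear. induction t as [|n IH]; [simpl; ring|].
    cbn [sumR]. rewrite IH. ring.
Qed.

Lemma meanh_S J t k :
  meanh J (S t) (S k) = INR J / (INR J + 1) * meanh J t k + / (INR J + 1) * meanh J t (S k).
Proof.
  unfold meanh. rewrite <- !Einf_scal, <- Einf_plus.
  rewrite (Einf_ext J (S t) _ (fun eta => sumR (fun y => (if Nat.leb y (S k) then 0 else 1) * IZR (eta y)) (S t)))
    by (intros; apply hh_sum; assumption).
  rewrite (Einf_linear_step J t (fun y => if Nat.leb y (S k) then 0 else 1)).
  cbn [Nat.leb]. rewrite Rmult_0_r, Rplus_0_l. apply Einf_ext. intros eta HV.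
  rewrite (hh_sum J t eta k HV), (hh_sum J t eta (S k) HV). clear.
  induction t as [|t IH]; [simpl; ring|]. cbn [sumR]. rewrite IH. unfold wstep. cbn [Nat.leb]. ring.
Qed.

Lemma meanh_0 J t : meanh J t 0 = INR J * INR t.
Proof.
  unfold meanh. rewrite <- (Einf_const J t (INR J * INR t)). apply Einf_ext. intros eta _.
  unfold hh, psum. simpl. ring.
Qed.

Lemma meanh_init J k : meanh J 0 k = 0.
Proof.
  unfold meanh. rewrite <- (Einf_const J 0 0). apply Einf_ext. intros eta HV.
  apply hh_out; [assumption | lia].
Qed.

Lemma meanh_decr J t k : 0 <= meanh J t k - meanh J t (S k) <= INR J + 1.
Proof.
  assert (E : meanh J t k = meanh J t (S k) + Einf J t (fun eta => IZR (eta (S k)))).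
  { unfold meanh. rewrite <- Einf_plus. apply Einf_ext. intros eta _. rewrite hh_S. ring. }
  rewrite E. split.
  - rewrite <- (Rplus_0_r (meanh J t (S k))) at 2.
    assert (Einf J t (fun _ => 0) <= Einf J t (fun eta => IZR (eta (S k)))); [|rewrite Einf_const in H; lra].
    apply Einf_le. intros eta HV. apply (valid_IZR J t eta (S k) HV). lia.
  - assert (Einf J t (fun eta => IZR (eta (S k))) <= Einf J t (fun _ => INR J + 1)); [|rewrite Einf_const in H; lra].
    apply Einf_le. intros eta HV. apply (valid_IZR J t eta (S k) HV). lia.
Qed.

(** * Finite products and exponential inequalities *)

Fixpoint prodR (f : nat -> R) (m : nat) : R :=
  match m with O => 1 | S m' => prodR f m' * f m' end.

Lemma cluster_prodR fac h a c m : cluster fac h a c m = prodR (fun j => fac h a (c + j)%nat) m.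
Proof.
  revert c. induction m as [|m IH]; intros c; [reflexivity|].
  cbn [cluster]. rewrite IH. clear IH. induction m as [|m IH].
  - simpl. rewrite Nat.add_0_r. ring.
  - change (prodR (fun j => fac h a (S c + j)%nat) (S m))
      with (prodR (fun j => fac h a (S c + j)%nat) m * fac h a (S c + m)%nat).
    rewrite <- Rmult_assoc, IH, Nat.add_succ_comm. reflexivity.
Qed.

Lemma prodR_const x m : prodR (fun _ => x) m = x ^ m.
Proof. induction m as [|m IH]; simpl; [reflexivity | rewrite IH; ring]. Qed.

Lemma prodR_bound f m W : (forall j, (j < m)%nat -> Rabs (f j) <= W) -> Rabs (prodR f m) <= W ^ m.
Proof.
  induction m as [|m IH]; intros H; simpl; [rewrite Rabs_R1; lra|].
  rewrite Rabs_mult, Rmult_comm. apply Rmult_le_compat; try apply Rabs_pos.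
  - apply H; lia.
  - apply IH. intros; apply H; lia.
Qed.

Lemma prodR_lower f m w : 0 <= w -> (forall j, (j < m)%nat -> w <= f j) -> w ^ m <= prodR f m.
Proof.
  intros Hw. induction m as [|m IH]; intros H; simpl; [lra|].
  rewrite Rmult_comm. apply Rmult_le_compat; try apply pow_le; try assumption.
  - apply IH. intros; apply H; lia.
  - apply H; lia.
Qed.

(** Factors are exchanged one at a time. Each exchange costs [d] times the other factors, and
    [1 <= W] allows the full power [W ^ m] as a common bound. *)
Lemma prodR_perturb f g m d W : 1 <= W ->
  (forall j, (j < m)%nat -> Rabs (f j - g j) <= d /\ Rabs (f j) <= W /\ Rabs (g j) <= W) ->
  Rabs (prodR f m - prodR g m) <= INR m * d * W ^ m.
Proof.
  intros HW. induction m as [|m IH]; intros H.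
  - simpl. rewrite Rminus_diag, Rabs_R0. lra.
  - destruct (H m ltac:(lia)) as (Hd & Hf & Hg).
    specialize (IH ltac:(intros; apply H; lia)).
    assert (Hgb : Rabs (prodR g m) <= W ^ m) by (apply prodR_bound; intros; apply H; lia).
    cbn [prodR pow]. rewrite S_INR.
    replace (prodR f m * f m - prodR g m * g m) with
      (f m * (prodR f m - prodR g m) + (f m - g m) * prodR g m) by ring.
    eapply Rle_trans; [apply Rabs_triang|]. rewrite !Rabs_mult.
    assert (0 <= d) by (pose proof (Rabs_pos (f m - g m)); lra).
    assert (HWm : 0 <= W ^ m) by (apply pow_le; lra).
    assert (Rabs (f m) * Rabs (prodR f m - prodR g m) <= W * (INR m * d * W ^ m))
      by (apply Rmult_le_compat; auto using Rabs_pos).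
    assert (Rabs (f m - g m) * Rabs (prodR g m) <= d * W ^ m)
      by (apply Rmult_le_compat; auto using Rabs_pos).
    assert (d * W ^ m <= W * (d * W ^ m)).
    { rewrite <- (Rmult_1_l (d * W ^ m)) at 1. apply Rmult_le_compat_r; [|assumption].
      apply Rmult_le_pos; assumption. }
    lra.
Qed.

Lemma le_by_derivative (f f' : R -> R) (b : R) : 0 <= b ->
  (forall x, 0 <= x <= b -> is_derive f x (f' x)) -> (forall x, 0 <= x <= b -> 0 <= f' x) ->
  f 0 <= f b.
Proof.
  intros Hb Hd Hp.
  destruct (MVT_gen f 0 b f') as (c & Hc & E).
  - intros x Hx. apply Hd. rewrite Rmin_left, Rmax_right in Hx; lra.
  - intros x Hx. apply continuity_pt_filterlim, (ex_derive_continuous f).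
    exists (f' x). apply Hd. rewrite Rmin_left, Rmax_right in Hx; lra.
  - rewrite Rmin_left, Rmax_right in Hc by lra. specialize (Hp c Hc).
    assert (0 <= f' c * (b - 0)) by (apply Rmult_le_pos; lra). lra.
Qed.

Lemma exp_lower2 y : 0 <= y -> 1 + y + y ^ 2 / 2 <= exp y.
Proof.
  intros Hy.
  pose proof (le_by_derivative (fun y => exp y - (1 + y + y ^ 2 / 2)) (fun y => exp y - (1 + y)) y Hy) as G.
  cbv beta in G. rewrite exp_0 in G.
  enough (1 - (1 + 0 + 0 ^ 2 / 2) <= exp y - (1 + y + y ^ 2 / 2)) by lra.
  apply G.
  - intros x _. auto_derive; [auto|]. simpl. lra.
  - intros x _. pose proof (exp_ineq1_le x). lra.
Qed.

(** The third derivative of the difference is [6 - exp y], which is nonnegative on the unit interval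
    since [exp 1 <= 3]. It is integrated three times, each time from the value 0 at the origin. *)
Lemma exp_upper3 y : 0 <= y <= 1 -> exp y <= 1 + y + y ^ 2 / 2 + y ^ 3.
Proof.
  intros Hy.
  assert (G2 : forall x, 0 <= x <= 1 -> 0 <= 1 + 6 * x - exp x).
  { intros x Hx.
    pose proof (le_by_derivative (fun y => 1 + 6 * y - exp y) (fun y => 6 - exp y) x ltac:(lra)) as G.
    cbv beta in G. rewrite exp_0 in G.
    enough (1 + 6 * 0 - 1 <= 1 + 6 * x - exp x) by lra. apply G.
    - intros z _. auto_derive; [auto|]. lra.
    - intros z Hz. pose proof (exp_mono z 1 ltac:(lra)). pose proof exp_le_3. lra. }
  assert (G1 : forall x, 0 <= x <= 1 -> 0 <= 1 + x + 3 * x ^ 2 - exp x).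
  { intros x Hx.
    pose proof (le_by_derivative (fun y => 1 + y + 3 * y ^ 2 - exp y) (fun y => 1 + 6 * y - exp y) x ltac:(lra)) as G.
    cbv beta in G. rewrite exp_0 in G.
    enough (1 + 0 + 3 * 0 ^ 2 - 1 <= 1 + x + 3 * x ^ 2 - exp x) by lra. apply G.
    - intros z _. auto_derive; [auto|]. simpl. lra.
    - intros z Hz. apply G2. lra. }
  pose proof (le_by_derivative (fun y => 1 + y + y ^ 2 / 2 + y ^ 3 - exp y)
    (fun y => 1 + y + 3 * y ^ 2 - exp y) y ltac:(lra)) as G.
  cbv beta in G. rewrite exp_0 in G.
  enough (1 + 0 + 0 ^ 2 / 2 + 0 ^ 3 - 1 <= 1 + y + y ^ 2 / 2 + y ^ 3 - exp y) by lra. apply G.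
  - intros z _. auto_derive; [auto|]. simpl. lra.
  - intros z Hz. apply G1. lra.
Qed.

(** The inequality [z / m <= exp (z / m)], raised to the power [m]. *)
Lemma pow_le_exp z m : 0 <= z -> z ^ m <= INR m ^ m * exp z.
Proof.
  intros Hz. destruct m as [|m]; [simpl; pose proof (exp_ineq1_le z); lra|].
  assert (Hm : 0 < INR (S m)) by (apply lt_0_INR; lia).
  assert (E : exp z = exp (z / INR (S m)) ^ S m).
  { rewrite <- (exp_INR_ln (exp _)) by apply exp_pos. rewrite ln_exp. f_equal. field. lra. }
  rewrite E, <- Rpow_mult_distr. apply pow_incr. split; [assumption|].
  pose proof (exp_ineq1_le (z / INR (S m))).
  apply Rle_trans with (INR (S m) * (z / INR (S m))).
  - right. field. lra.
  - apply Rmult_le_compat_l; lra.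
Qed.

(** * Moments of the limiting height *)

(** The weight [w = exp (x / u) - 1] turns [1 + w] into [exp (x / u)]. As [u >= 2], the argument
    [x / u] is at most 1/2, so the cubic term of the exponential bound is at most half the
    square. *)
Lemma Einf_exp_scaled J t k x : 2 <= meanh J t k -> 0 <= x <= 1 ->
  Einf J t (fun eta => exp (x * (hh J t eta k / meanh J t k)))
  <= exp (x + x ^ 2 / meanh J t k).
Proof.
  intros Hu Hx. set (u := meanh J t k) in *.
  assert (Hxu : 0 <= x / u <= 1 / 2).
  { split; [apply Rdiv_le_0_compat; lra|]. apply Rle_div_l; lra. }
  pose proof (exp_ineq1_le (x / u)) as H1.
  pose proof (Einf_exp_h J t k (exp (x / u) - 1) ltac:(lra)) as H. fold u in H.
  replace (1 + (exp (x / u) - 1)) with (exp (x / u)) in H by ring. rewrite ln_exp in H.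
  eapply Rle_trans; [|eapply Rle_trans; [exact H|]].
  - apply Einf_le. intros eta _. right. f_equal. field. lra.
  - apply exp_mono. pose proof (exp_upper3 (x / u) ltac:(lra)) as H2.
    assert (exp (x / u) - 1 <= x / u + (x / u) ^ 2).
    { assert ((x / u) ^ 3 <= (x / u) ^ 2 / 2); [|lra].
      change ((x / u) ^ 3) with (x / u * (x / u) ^ 2).
      assert (0 <= (x / u) ^ 2) by (apply pow_le; lra). nra. }
    apply Rle_trans with ((x / u + (x / u) ^ 2) * u).
    + apply Rmult_le_compat_r; lra.
    + right. field. lra.
Qed.

Lemma scaled_h_nonneg J t k eta : 2 <= meanh J t k -> valid J t eta ->
  0 <= hh J t eta k / meanh J t k.
Proof. intros Hu HV. apply Rdiv_le_0_compat; [apply hh_nonneg, HV | lra]. Qed.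

(** The power is dominated by an exponential, whose mean is bounded at [x = 1]. The exponent
    collects [K], the 1 of the mean and at most 1 from [1 / u]. *)
Lemma Einf_scaled_power J t k m K : 2 <= meanh J t k -> 0 <= K ->
  Einf J t (fun eta => (hh J t eta k / meanh J t k + K) ^ m) <= INR m ^ m * exp (K + 2).
Proof.
  intros Hu HK. pose proof (Einf_exp_scaled J t k 1 Hu ltac:(lra)) as H.
  apply Rle_trans with (Einf J t (fun eta => INR m ^ m * exp K * exp (1 * (hh J t eta k / meanh J t k)))).
  - apply Einf_le. intros eta HV. rewrite Rmult_assoc, <- exp_plus.
    replace (K + 1 * (hh J t eta k / meanh J t k)) with (hh J t eta k / meanh J t k + K) by ring.
    apply pow_le_exp. pose proof (scaled_h_nonneg J t k eta Hu HV). lra.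
  - rewrite Einf_scal, exp_plus, <- Rmult_assoc. apply Rmult_le_compat_l.
    + apply Rmult_le_pos; [apply pow_le, pos_INR | apply Rlt_le, exp_pos].
    + eapply Rle_trans; [exact H|]. apply exp_mono.
      assert (1 ^ 2 / meanh J t k <= 1); [|lra]. apply Rle_div_l; lra.
Qed.

Lemma Einf_scaled_mean J t k : 2 <= meanh J t k ->
  Einf J t (fun eta => hh J t eta k / meanh J t k) = 1.
Proof.
  intros Hu. unfold Rdiv.
  rewrite (Einf_ext J t _ (fun eta => / meanh J t k * hh J t eta k)) by (intros; ring).
  rewrite Einf_scal. fold (meanh J t k). field. lra.
Qed.

(* Expanding the generating function bound at [theta = 1 / u^2] to second order. *)
Lemma Einf_scaled_variance J t k : 2 <= meanh J t k ->
  Einf J t (fun eta => (hh J t eta k / meanh J t k - 1) ^ 2) <= 8 / meanh J t k.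
Proof.
  intros Hu. set (u := meanh J t k) in *. set (e := / u).
  assert (He : 0 < e <= 1 / 2).
  { unfold e. split; [apply Rinv_0_lt_compat; lra|].
    replace (1 / 2) with (/ 2) by field. apply Rinv_le_contravar; lra. }
  pose proof (Einf_exp_scaled J t k e Hu ltac:(lra)) as H.
  pose proof (Einf_scaled_mean J t k Hu) as Hmean. fold u in H, Hmean.
  set (M := Einf J t (fun eta => (hh J t eta k / u) ^ 2)).
  assert (L : 1 + e * 1 + e ^ 2 / 2 * M <= Einf J t (fun eta => exp (e * (hh J t eta k / u)))).
  { replace (1 + e * 1 + e ^ 2 / 2 * M) with
      (Einf J t (fun eta => 1 + e * (hh J t eta k / u) + e ^ 2 / 2 * (hh J t eta k / u) ^ 2))
      by (rewrite !Einf_plus, !Einf_scal, Einf_const, Hmean; reflexivity).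
    apply Einf_le. intros eta HV.
    pose proof (scaled_h_nonneg J t k eta Hu HV) as Hz. fold u in Hz.
    eapply Rle_trans; [|apply exp_lower2; apply Rmult_le_pos; lra]. right. field. lra. }
  replace (e ^ 2 / u) with (e ^ 3) in H by (unfold e; field; lra).
  assert (Hy : 0 <= e + e ^ 3 <= 1).
  { assert (e ^ 2 <= 1 / 4) by (simpl; nra). assert (0 <= e ^ 2) by (apply pow_le; lra).
    replace (e ^ 3) with (e * e ^ 2) by ring. nra. }
  pose proof (exp_upper3 _ Hy) as H3.
  (* Removing [1 + e] and dividing by [e ^ 2 / 2] bounds [M] by
     [2 e + (1 + e^2)^2 + 2 e (1 + e^2)^3]. Since [e <= 1/2], the three summands are at most [2 e],
     [1 + 3 e / 2] and [4 e]. *)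
  assert (HM : M <= 1 + 8 * e).
  { apply Rmult_le_reg_l with (e ^ 2 / 2); [assert (0 < e ^ 2) by (apply pow_lt; lra); lra|].
    apply Rle_trans with (e ^ 3 + (e + e ^ 3) ^ 2 / 2 + (e + e ^ 3) ^ 3); [lra|].
    replace (e ^ 3 + (e + e ^ 3) ^ 2 / 2 + (e + e ^ 3) ^ 3)
      with (e ^ 2 / 2 * (2 * e + (1 + e ^ 2) ^ 2 + 2 * e * (1 + e ^ 2) ^ 3)) by field.
    apply Rmult_le_compat_l; [assert (0 < e ^ 2) by (apply pow_lt; lra); lra|].
    assert (Hs : 0 <= e ^ 2 <= e / 2) by (simpl; nra). set (q := e ^ 2) in *.
    assert ((1 + q) ^ 2 <= 1 + 3 * q) by (simpl; nra).
    assert ((1 + q) ^ 3 <= 2).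
    { apply Rle_trans with ((1 + 1 / 4) ^ 3); [apply pow_incr; lra | lra]. }
    nra. }
  apply Rle_trans with (M + (-2 * 1 + 1)); [right|unfold Rdiv; fold e; lra].
  replace (M + (-2 * 1 + 1)) with
    (Einf J t (fun eta => (hh J t eta k / u) ^ 2 + (-2 * (hh J t eta k / u) + 1)))
    by (rewrite !Einf_plus, !Einf_scal, Einf_const, Hmean; reflexivity).
  apply Einf_ext. intros; ring.
Qed.

Lemma pow_minus_one z m : 0 <= z -> Rabs (z ^ m - 1) <= INR m * (Rabs (z - 1) * (z + 1) ^ m).
Proof.
  intros Hz. induction m as [|m IH].
  - simpl. rewrite Rminus_diag, Rabs_R0. lra.
  - rewrite S_INR. simpl pow. replace (z * z ^ m - 1) with (z * (z ^ m - 1) + (z - 1)) by ring.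
    eapply Rle_trans; [apply Rabs_triang|]. rewrite Rabs_mult, (Rabs_pos_eq z) by assumption.
    set (A := Rabs (z - 1)) in *. set (p := (z + 1) ^ m) in *.
    assert (1 <= p) by (apply pow_R1_Rle; lra). assert (0 <= A) by apply Rabs_pos.
    assert (0 <= INR m * (A * p)).
    { apply Rmult_le_pos; [apply pos_INR|]. apply Rmult_le_pos; lra. }
    assert (z * Rabs (z ^ m - 1) <= z * (INR m * (A * p))) by (apply Rmult_le_compat_l; lra).
    assert (A <= A * ((z + 1) * p)).
    { rewrite <- (Rmult_1_r A) at 1. apply Rmult_le_compat_l; nra. }
    nra.
Qed.

Lemma Einf_Rabs J t f : Rabs (Einf J t f) <= Einf J t (fun eta => Rabs (f eta)).
Proof.
  apply Rabs_le. split.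
  - replace (- Einf J t (fun eta => Rabs (f eta))) with (Einf J t (fun eta => -1 * Rabs (f eta)))
      by (rewrite Einf_scal; ring).
    apply Einf_le. intros eta _. pose proof (Rle_abs (- f eta)). rewrite Rabs_Ropp in H. lra.
  - apply Einf_le. intros eta _. apply Rle_abs.
Qed.

Lemma ffall_scaled h u m : u <> 0 -> ffall h m / u ^ m = prodR (fun j => h / u - INR j / u) m.
Proof.
  intros Hu. unfold ffall. rewrite cluster_prodR. induction m as [|m IH]; simpl; [field|].
  simpl in IH. rewrite <- IH. field. split; [|apply pow_nonzero]; assumption.
Qed.

(** Passing from the falling factorial to the power costs order [1 / u], collected in [C1]. Passing
    from the power to 1 costs a standard deviation, of order [1 / sqrt u], collected in [C2]; the
    exponent [N = 2 m] comes from squaring in the weighted inequality between the two means. *)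
Theorem Einf_ffall_asymptotic J m : exists C, 0 <= C /\ forall t k, 2 <= meanh J t k ->
  Rabs (Einf J t (fun eta => ffall (hh J t eta k) m) / meanh J t k ^ m - 1)
  <= C / sqrt (meanh J t k).
Proof.
  set (N := (2 * m)%nat).
  set (C1 := INR m * (INR m * (INR m ^ m * exp (INR m + 1 + 2)))).
  set (C2 := INR m * / 2 * (8 + INR N ^ N * exp (1 + 2))).
  assert (HC1 : 0 <= C1).
  { unfold C1. repeat apply Rmult_le_pos; try apply pos_INR; [apply pow_le, pos_INR | apply Rlt_le, exp_pos]. }
  assert (HC2 : 0 <= C2).
  { unfold C2. apply Rmult_le_pos; [apply Rmult_le_pos; [apply pos_INR|lra]|].
    assert (0 <= INR N ^ N * exp (1 + 2)); [|lra].
    apply Rmult_le_pos; [apply pow_le, pos_INR | apply Rlt_le, exp_pos]. }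
  exists (C1 + C2). split; [lra|]. intros t k Hu. set (u := meanh J t k) in *.
  set (Z := fun eta => hh J t eta k / u).
  assert (HZ : forall eta, valid J t eta -> 0 <= Z eta) by (intros; apply scaled_h_nonneg; assumption).
  assert (Hsq : 1 <= sqrt u) by (rewrite <- sqrt_1; apply sqrt_le_1; lra).
  assert (Hss : sqrt u * sqrt u = u) by (apply sqrt_sqrt; lra).
  assert (E : Einf J t (fun eta => ffall (hh J t eta k) m) / u ^ m - 1
    = Einf J t (fun eta => (prodR (fun j => Z eta - INR j / u) m - prodR (fun _ => Z eta) m)
                           + (Z eta ^ m - 1))).
  { unfold Rdiv at 1. rewrite Rmult_comm, <- Einf_scal.
    unfold Rminus at 1. rewrite <- (Einf_const J t (- (1))), <- Einf_plus. apply Einf_ext.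
    intros eta _. unfold Z. rewrite <- ffall_scaled by lra. rewrite prodR_const. unfold Rdiv. ring. }
  rewrite E. eapply Rle_trans; [apply Einf_Rabs|].
  apply Rle_trans with (Einf J t (fun eta =>
     INR m * (INR m / u) * (Z eta + (INR m + 1)) ^ m
     + INR m * / 2 * (sqrt u * (Z eta - 1) ^ 2 + / sqrt u * (Z eta + 1) ^ N))).
  - apply Einf_le. intros eta HV. specialize (HZ eta HV).
    eapply Rle_trans; [apply Rabs_triang|]. apply Rplus_le_compat.
    + apply prodR_perturb; [pose proof (pos_INR m); lra|]. intros j Hj.
      assert (Hjm : INR j <= INR m) by (apply le_INR; lia). pose proof (pos_INR j) as Hj0.
      assert (0 <= INR j / u <= INR m / u).
      { split; [apply Rdiv_le_0_compat; lra|]. apply Rmult_le_compat_r; [|lra].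
        apply Rlt_le, Rinv_0_lt_compat; lra. }
      assert (INR m / u <= INR m) by (apply Rle_div_l; nra).
      repeat split.
      * replace (Z eta - INR j / u - Z eta) with (- (INR j / u)) by ring.
        rewrite Rabs_Ropp, Rabs_pos_eq; lra.
      * apply Rabs_le; lra.
      * apply Rabs_le; lra.
    + eapply Rle_trans; [apply pow_minus_one; assumption|]. rewrite Rmult_assoc.
      apply Rmult_le_compat_l; [apply pos_INR|].
      (* AM-GM with weights [sqrt u] and [1 / sqrt u] *)
      set (A := Rabs (Z eta - 1)). set (p := (Z eta + 1) ^ m).
      replace ((Z eta - 1) ^ 2) with (A * A)
        by (unfold A; rewrite <- Rabs_mult, Rabs_pos_eq; [ring | apply Rle_0_sqr]).
      replace ((Z eta + 1) ^ N) with (p * p) by (unfold p, N; rewrite <- pow_add; f_equal; lia).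
      assert (Hd : sqrt u * (A * A) + / sqrt u * (p * p) - 2 * (A * p) = / sqrt u * (sqrt u * A - p) ^ 2)
        by (field; lra).
      assert (0 <= / sqrt u * (sqrt u * A - p) ^ 2).
      { apply Rmult_le_pos; [apply Rlt_le, Rinv_0_lt_compat; lra | apply pow2_ge_0]. }
      lra.
  - rewrite Einf_plus, !Einf_scal, Einf_plus, !Einf_scal.
    pose proof (Einf_scaled_power J t k m (INR m + 1) Hu ltac:(pose proof (pos_INR m); lra)) as B1.
    pose proof (Einf_scaled_power J t k N 1 Hu ltac:(lra)) as B2.
    pose proof (Einf_scaled_variance J t k Hu) as B3. fold u in B1, B2, B3.
    unfold Z. pose proof (pos_INR m) as Hm.
    replace ((C1 + C2) / sqrt u) with (C1 * / sqrt u + C2 * / sqrt u) by (unfold Rdiv; ring).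
    apply Rplus_le_compat.
    + apply Rle_trans with (INR m * (INR m / u) * (INR m ^ m * exp (INR m + 1 + 2))).
      * apply Rmult_le_compat_l; [|exact B1]. apply Rmult_le_pos; [assumption|].
        apply Rdiv_le_0_compat; lra.
      * unfold Rdiv. replace (INR m * (INR m * / u) * (INR m ^ m * exp (INR m + 1 + 2))) with (C1 * / u)
          by (unfold C1; ring).
        apply Rmult_le_compat_l; [assumption|]. apply Rinv_le_contravar; nra.
    + unfold C2. rewrite (Rmult_assoc (INR m * / 2) (8 + _)). apply Rmult_le_compat_l; [apply Rmult_le_pos; lra|].
      rewrite Rmult_plus_distr_r. apply Rplus_le_compat.
      * apply Rle_trans with (sqrt u * (8 / u)); [apply Rmult_le_compat_l; lra|].
        right. rewrite <- Hss at 2. field. lra.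
      * rewrite Rmult_comm. apply Rmult_le_compat_r; [|exact B2].
        apply Rlt_le, Rinv_0_lt_compat; lra.
Qed.

(** * Wallis and Stirling *)

Definition wallis (n : nat) : R := RInt (fun x => sin x ^ n) 0 (PI / 2).

Lemma continuous_sin_pow n x : continuous (fun x => sin x ^ n) x.
Proof.
  apply (ex_derive_continuous (fun x => sin x ^ n)). auto_derive. auto.
Qed.

Lemma ex_RInt_sin_pow n : ex_RInt (fun x => sin x ^ n) 0 (PI / 2).
Proof. apply (ex_RInt_continuous (V := R_CompleteNormedModule)). intros; apply continuous_sin_pow. Qed.

Lemma wallis_0 : wallis 0 = PI / 2.
Proof. unfold wallis. simpl. rewrite RInt_const. unfold scal; simpl; unfold mult; simpl. ring. Qed.

Lemma wallis_1 : wallis 1 = 1.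
Proof.
  unfold wallis. apply is_RInt_unique.
  replace 1 with (- cos (PI / 2) - (- cos 0)) by (rewrite cos_PI2, cos_0; ring).
  apply (is_RInt_ext sin); [intros; simpl; ring|].
  apply (is_RInt_derive (fun x => - cos x) sin).
  - intros x _. auto_derive; [auto | ring].
  - intros x _. apply (ex_derive_continuous sin). auto_derive. auto.
Qed.

(** The difference of the two integrands is the derivative of [- cos x * sin x ^ (n + 1)], which
    vanishes at both end points. *)
Lemma wallis_rec n : INR (n + 2) * wallis (n + 2) = INR (n + 1) * wallis n.
Proof.
  assert (H : is_RInt (fun x => INR (n + 2) * sin x ^ (n + 2) - INR (n + 1) * sin x ^ n) 0 (PI / 2)
                (- cos (PI / 2) * sin (PI / 2) ^ (n + 1) - (- cos 0 * sin 0 ^ (n + 1)))).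
  { apply (is_RInt_derive (fun x => - cos x * sin x ^ (n + 1))).
    - intros x _. auto_derive; [auto|].
      replace (n + 2)%nat with (S (S n)) by lia. replace (n + 1)%nat with (S n) by lia.
      rewrite !S_INR. simpl pred. simpl pow.
      pose proof (sin2_cos2 x) as E. unfold Rsqr in E.
      apply Rminus_diag_uniq.
      transitivity ((INR n + 1) * sin x ^ n * (1 - (sin x * sin x + cos x * cos x))); [ring|].
      rewrite E. ring.
    - intros x _. apply (ex_derive_continuous (fun x => INR (n + 2) * sin x ^ (n + 2) - INR (n + 1) * sin x ^ n)).
      auto_derive. auto. }
  rewrite cos_PI2, sin_0, pow_i in H by lia.
  apply (is_RInt_unique (V := R_CompleteNormedModule)) in H.
  rewrite (RInt_minus (V := R_CompleteNormedModule) (fun x => INR (n + 2) * sin x ^ (n + 2)) (fun x => INR (n + 1) * sin x ^ n)) in H.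
  - rewrite (RInt_scal (V := R_CompleteNormedModule) (fun x => sin x ^ (n + 2))) in H by apply ex_RInt_sin_pow.
    rewrite (RInt_scal (V := R_CompleteNormedModule) (fun x => sin x ^ n)) in H by apply ex_RInt_sin_pow.
    unfold minus, plus, opp, scal in H; simpl in H; unfold mult in H; simpl in H.
    fold (wallis (n + 2)) (wallis n) in H. lra.
  - apply (ex_RInt_scal (V := R_CompleteNormedModule) (fun x => sin x ^ (n + 2))), ex_RInt_sin_pow.
  - apply (ex_RInt_scal (V := R_CompleteNormedModule) (fun x => sin x ^ n)), ex_RInt_sin_pow.
Qed.

Lemma wallis_decr n : wallis (S n) <= wallis n.
Proof.
  unfold wallis. pose proof PI_RGT_0. apply RInt_le; try apply ex_RInt_sin_pow; [lra|].
  intros x Hx. simpl. assert (0 <= sin x) by (apply sin_ge_0; lra).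
  pose proof (SIN_bound x). assert (0 <= sin x ^ n) by (apply pow_le; assumption). nra.
Qed.

Lemma wallis_even n : wallis (2 * n) * (4 ^ n * INR (fact n) ^ 2) = PI / 2 * INR (fact (2 * n)).
Proof.
  induction n as [|n IH].
  - simpl Nat.mul. rewrite wallis_0. simpl. ring.
  - replace (2 * S n)%nat with (2 * n + 2)%nat by lia.
    pose proof (wallis_rec (2 * n)) as E.
    replace (fact (2 * n + 2)) with ((2 * n + 2) * ((2 * n + 1) * fact (2 * n)))%nat
      by (replace (2 * n + 2)%nat with (S (S (2 * n))) by lia; cbn [fact]; lia).
    change (fact (S n)) with (S n * fact n)%nat. rewrite !mult_INR.
    apply Rmult_eq_reg_l with (INR (2 * n + 2)); [|apply not_0_INR; lia].
    rewrite <- (Rmult_assoc (INR (2 * n + 2)) (wallis _)), E.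
    replace (PI / 2 * (INR (2 * n + 2) * (INR (2 * n + 1) * INR (fact (2 * n)))))
      with (INR (2 * n + 2) * INR (2 * n + 1) * (PI / 2 * INR (fact (2 * n)))) by ring.
    rewrite <- IH. rewrite S_INR, !plus_INR, !mult_INR. simpl. ring.
Qed.

Lemma wallis_pos n : 0 < wallis n.
Proof.
  assert (G : 0 < wallis n /\ 0 < wallis (S n)); [|apply G].
  induction n as [|n IH].
  - rewrite wallis_0, wallis_1. pose proof PI_RGT_0. lra.
  - split; [apply IH|]. pose proof (wallis_rec n) as E.
    replace (n + 2)%nat with (S (S n)) in E by lia.
    assert (0 < INR (S (S n))) by (apply lt_0_INR; lia).
    assert (0 < INR (n + 1) * wallis n) by (apply Rmult_lt_0_compat; [apply lt_0_INR; lia | apply IH]).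
    rewrite <- E in H0. apply Rmult_lt_reg_l with (INR (S (S n))); [assumption | lra].
Qed.

(** By the recurrence this product does not depend on [n]. *)
Lemma wallis_product n : INR (S n) * wallis (S n) * wallis n = PI / 2.
Proof.
  induction n as [|n IH].
  - rewrite wallis_0, wallis_1. simpl. ring.
  - pose proof (wallis_rec n) as E.
    replace (n + 2)%nat with (S (S n)) in E by lia. replace (n + 1)%nat with (S n) in E by lia.
    rewrite E, <- IH. ring.
Qed.

(** Monotonicity places [wallis (2 n) ^ 2] between the products of [wallis (2 n)] with its two
    neighbours, and [wallis_product] evaluates both. *)
Lemma wallis_limit : is_lim_seq (fun n => INR n * wallis (2 * n) ^ 2) (PI / 4).
Proof.
  assert (Hlow : forall n, PI / 4 - PI / 4 * / (INR n + 1) <= INR n * wallis (2 * n) ^ 2).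
  { intros n. pose proof (wallis_product (2 * n)) as E. pose proof (wallis_decr (2 * n)) as D.
    pose proof (wallis_pos (2 * n)) as P. pose proof (pos_INR n). pose proof PI_RGT_0.
    assert (HS : INR (S (2 * n)) = 2 * INR n + 1) by (rewrite S_INR, mult_INR; simpl; ring).
    rewrite HS in E.
    assert (K : PI / 2 <= (2 * INR n + 1) * wallis (2 * n) ^ 2).
    { rewrite <- E, Rmult_assoc. apply Rmult_le_compat_l; [lra|].
      replace (wallis (2 * n) ^ 2) with (wallis (2 * n) * wallis (2 * n)) by ring.
      apply Rmult_le_compat_r; lra. }
    apply Rle_trans with (INR n * (PI / 2 * / (2 * INR n + 1))).
    - apply Rminus_le_0.
      replace (INR n * (PI / 2 * / (2 * INR n + 1)) - (PI / 4 - PI / 4 * / (INR n + 1)))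
        with (PI / 4 * (INR n * / ((2 * INR n + 1) * (INR n + 1)))) by (field; lra).
      apply Rmult_le_pos; [lra|]. apply Rmult_le_pos; [lra|].
      apply Rlt_le, Rinv_0_lt_compat. nra.
    - apply Rmult_le_compat_l; [lra|].
      apply (Rmult_le_reg_l (2 * INR n + 1)); [lra|].
      replace ((2 * INR n + 1) * (PI / 2 * / (2 * INR n + 1))) with (PI / 2) by (field; lra). exact K. }
  assert (Hup : forall n, INR n * wallis (2 * n) ^ 2 <= PI / 4).
  { intros [|n]; [simpl; pose proof PI_RGT_0; lra|].
    pose proof (wallis_product (2 * n + 1)) as E. pose proof (wallis_decr (2 * n + 1)) as D.
    replace (S (2 * n + 1)) with (2 * S n)%nat in * by lia.
    pose proof (wallis_pos (2 * S n)) as P.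
    assert (HS : INR (2 * S n) = 2 * INR (S n)) by (rewrite mult_INR; simpl; ring).
    rewrite HS in E. pose proof (pos_INR (S n)).
    assert (INR (S n) * wallis (2 * S n) ^ 2 <= INR (S n) * (wallis (2 * S n) * wallis (2 * n + 1))).
    { apply Rmult_le_compat_l; [lra|]. replace (wallis (2 * S n) ^ 2) with (wallis (2 * S n) * wallis (2 * S n)) by ring.
      apply Rmult_le_compat_l; lra. }
    lra. }
  apply is_lim_seq_le_le with (u := fun n => PI / 4 - PI / 4 * / (INR n + 1)) (w := fun _ => PI / 4).
  - intros n. auto.
  - replace (Finite (PI / 4)) with (Finite (PI / 4 - PI / 4 * 0)) by (f_equal; ring).
    apply is_lim_seq_minus'; [apply is_lim_seq_const|].
    apply is_lim_seq_mult'; [apply is_lim_seq_const|].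
    apply (is_lim_seq_ext (fun n => / INR (S n))); [intros; now rewrite S_INR|].
    apply (is_lim_seq_inv _ p_infty); [|discriminate].
    apply -> (is_lim_seq_incr_1 INR). apply is_lim_seq_INR.
  - apply is_lim_seq_const.
Qed.

(** The logarithm of [n!] divided by [sqrt n * (n / e) ^ n]. *)
Definition stirling_log (n : nat) : R := ln (INR (fact n)) - (INR n + / 2) * ln (INR n) + INR n.

Lemma ln1p_lower x : 0 <= x -> 2 * x / (2 + x) <= ln (1 + x).
Proof.
  intros Hx.
  pose proof (le_by_derivative (fun x => ln (1 + x) - 2 * x / (2 + x))
     (fun x => x ^ 2 / ((1 + x) * (2 + x) ^ 2)) x Hx) as G. cbv beta in G.
  enough (ln (1 + 0) - 2 * 0 / (2 + 0) <= ln (1 + x) - 2 * x / (2 + x)).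
  { rewrite Rplus_0_r, ln_1 in H. lra. }
  apply G.
  - intros y Hy. auto_derive; [lra|]. field. lra.
  - intros y Hy. apply Rdiv_le_0_compat; [apply pow2_ge_0|].
    apply Rmult_lt_0_compat; [lra | apply pow_lt; lra].
Qed.

Lemma ln1p_upper x : 0 <= x -> ln (1 + x) <= x - x ^ 2 / 2 + x ^ 3 / 3.
Proof.
  intros Hx.
  pose proof (le_by_derivative (fun x => x - x ^ 2 / 2 + x ^ 3 / 3 - ln (1 + x))
     (fun x => x ^ 3 / (1 + x)) x Hx) as G. cbv beta in G.
  enough (0 - 0 ^ 2 / 2 + 0 ^ 3 / 3 - ln (1 + 0) <= x - x ^ 2 / 2 + x ^ 3 / 3 - ln (1 + x)).
  { rewrite Rplus_0_r, ln_1 in H. lra. }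
  apply G.
  - intros y Hy. auto_derive; [lra|]. field. lra.
  - intros y Hy. apply Rdiv_le_0_compat; [apply pow_le; lra | lra].
Qed.

(** With [x = 1 / n] the decrement is [(n + 1/2) ln (1 + x) - 1]. The lower bound for the logarithm
    makes it nonnegative; the upper one bounds it by [x^2 / 12 + x^3 / 6 <= x^2 / 4], and the
    telescoping difference on the right, [x^2 / (2 (1 + x))], is at least that since [x <= 1]. *)
Lemma stirling_log_step n : (1 <= n)%nat ->
  0 <= stirling_log n - stirling_log (S n) <= / 2 * / INR n - / 2 * / INR (S n).
Proof.
  intros Hn. assert (Hn1 : 1 <= INR n) by (apply (le_INR 1); lia).
  set (x := / INR n). assert (Hx : 0 < x <= 1).
  { unfold x. split; [apply Rinv_0_lt_compat; lra|]. rewrite <- Rinv_1. apply Rinv_le_contravar; lra. }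
  assert (Hnx : INR n = / x) by (unfold x; now rewrite Rinv_inv).
  assert (E : stirling_log n - stirling_log (S n) = (INR n + / 2) * ln (1 + x) - 1).
  { unfold stirling_log. change (fact (S n)) with (S n * fact n)%nat. rewrite mult_INR.
    assert (0 < INR (fact n)) by (apply lt_0_INR, lt_O_fact).
    rewrite ln_mult by (try assumption; rewrite S_INR; lra).
    assert (HS : ln (INR (S n)) = ln (INR n) + ln (1 + x)).
    { rewrite <- ln_mult by lra. f_equal. rewrite S_INR. unfold x. field. lra. }
    rewrite HS, S_INR. ring. }
  rewrite E. split.
  - pose proof (ln1p_lower x ltac:(lra)).
    assert ((INR n + / 2) * (2 * x / (2 + x)) = 1) by (rewrite Hnx; field; lra).
    assert ((INR n + / 2) * (2 * x / (2 + x)) <= (INR n + / 2) * ln (1 + x))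
      by (apply Rmult_le_compat_l; lra). lra.
  - pose proof (ln1p_upper x ltac:(lra)).
    assert ((INR n + / 2) * ln (1 + x) <= (INR n + / 2) * (x - x ^ 2 / 2 + x ^ 3 / 3))
      by (apply Rmult_le_compat_l; lra).
    assert ((INR n + / 2) * (x - x ^ 2 / 2 + x ^ 3 / 3) = 1 + x ^ 2 / 12 + x ^ 3 / 6)
      by (rewrite Hnx; field; lra).
    assert (H2 : 0 <= x ^ 2) by apply pow2_ge_0.
    assert (x ^ 3 <= x ^ 2) by (change (x ^ 3) with (x * x ^ 2); nra).
    assert (x ^ 2 / 4 <= / 2 * x - / 2 * / INR (S n)); [|lra].
    apply Rminus_le_0. rewrite S_INR, Hnx.
    replace (/ 2 * x - / 2 * / (/ x + 1) - x ^ 2 / 4) with (x ^ 2 * (1 - x) / (4 * (1 + x))).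
    + apply Rdiv_le_0_compat; [apply Rmult_le_pos; lra | lra].
    + field. lra.
Qed.

Lemma stirling_log_converges : exists l : R, is_lim_seq stirling_log l.
Proof.
  assert (H : ex_finite_lim_seq (fun n => stirling_log (S n))).
  { apply ex_finite_lim_seq_decr with (M := stirling_log 1 - / 2).
    - intros n. destruct (stirling_log_step (S n) ltac:(lia)). lra.
    - intros n.
      assert (stirling_log 1 - / 2 + / 2 * / INR (S n) <= stirling_log (S n)).
      { induction n as [|n IH]; [simpl; lra|].
        destruct (stirling_log_step (S n) ltac:(lia)). lra. }
      assert (0 < / INR (S n)) by (apply Rinv_0_lt_compat, lt_0_INR; lia). lra. }
  destruct H as (l & Hl). exists l. now apply is_lim_seq_incr_1.
Qed.

Lemma is_lim_seq_exp (f : nat -> R) (l : R) : is_lim_seq f l -> is_lim_seq (fun n => exp (f n)) (exp l).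
Proof.
  intros H. apply (is_lim_seq_continuous exp); [|exact H].
  apply derivable_continuous_pt, derivable_pt_exp.
Qed.

Lemma is_lim_seq_mul_index (f : nat -> R) (l : R) (c : nat) : (1 <= c)%nat ->
  is_lim_seq f l -> is_lim_seq (fun n => f (c * n)%nat) l.
Proof.
  intros Hc H. apply (is_lim_seq_subseq f l (fun n => (c * n)%nat)); [|exact H].
  apply eventually_subseq. intros n. nia.
Qed.

(** Convergence being known, the limit [l] is identified from [2 (S(2n) - 2 S(n))], with [S] for
    [stirling_log]. It tends to [-2 l], while its exponential is [2 / PI^2] times the sequence of
    [wallis_limit]. *)
Lemma stirling : is_lim_seq stirling_log (ln (2 * PI) / 2).
Proof.
  destruct stirling_log_converges as (l & Hl). pose proof PI_RGT_0 as HPI.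
  enough (E : exp (- 2 * l) = / (2 * PI)).
  { replace (ln (2 * PI) / 2) with l; [exact Hl|].
    apply (f_equal ln) in E. rewrite ln_exp, ln_Rinv in E by lra. lra. }
  assert (L1 : is_lim_seq (fun n => exp (2 * (stirling_log (2 * n) - 2 * stirling_log n))) (exp (- 2 * l))).
  { apply is_lim_seq_exp. replace (- 2 * l) with (2 * (l - 2 * l)) by ring.
    apply is_lim_seq_mult'; [apply is_lim_seq_const|]. apply is_lim_seq_minus'.
    - apply (is_lim_seq_mul_index stirling_log l 2); [lia | exact Hl].
    - apply is_lim_seq_mult'; [apply is_lim_seq_const | exact Hl]. }
  assert (L2 : is_lim_seq (fun n => exp (2 * (stirling_log (2 * n) - 2 * stirling_log n))) (/ (2 * PI))).
  { apply is_lim_seq_ext_loc with (u := fun n => 2 / PI ^ 2 * (INR n * wallis (2 * n) ^ 2)).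
    - exists 1%nat. intros n Hn. assert (Hn1 : 1 <= INR n) by (apply (le_INR 1); lia).
      assert (F1 : 0 < INR (fact n)) by (apply lt_0_INR, lt_O_fact).
      assert (F2 : 0 < INR (fact (2 * n))) by (apply lt_0_INR, lt_O_fact).
      assert (F4 : 0 < 4 ^ n) by (apply pow_lt; lra).
      pose proof (wallis_even n) as W.
      assert (Ew : wallis (2 * n) = PI / 2 * INR (fact (2 * n)) / (4 ^ n * INR (fact n) ^ 2)).
      { rewrite <- W. field. split; lra. }
      rewrite Ew. unfold stirling_log.
      replace (INR (2 * n)) with (2 * INR n) by (rewrite mult_INR; simpl; ring).
      rewrite ln_mult by lra.
      assert (E4 : 4 ^ n = exp (INR n * (2 * ln 2))).
      { replace (2 * ln 2) with (ln 4); [now rewrite exp_INR_ln by lra|].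
        replace 4 with (2 * 2) by ring. rewrite ln_mult by lra. ring. }
      match goal with |- _ = exp ?e => replace e with
        (ln (INR (fact (2 * n))) + ln (INR (fact (2 * n))) + ln (INR n)
         + - (ln 2 + (ln (INR (fact n)) + ln (INR (fact n)) + ln (INR (fact n)) + ln (INR (fact n)))
            + (INR n * (2 * ln 2) + INR n * (2 * ln 2)))) by field end.
      rewrite exp_plus, exp_Ropp, !exp_plus, !exp_ln, <- E4 by lra.
      field. lra.
    - replace (Finite (/ (2 * PI))) with (Finite (2 / PI ^ 2 * (PI / 4))) by (f_equal; field; lra).
      apply is_lim_seq_mult'; [apply is_lim_seq_const | apply wallis_limit]. }
  apply is_lim_seq_unique in L1. apply is_lim_seq_unique in L2. rewrite L1 in L2.
  now injection L2.
Qed.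

(** * The mean of the limiting process *)

(** The binomial point probability, defined by Pascal's rule because [meanh_S] has the same form. *)
Fixpoint binp (p q : R) (t k : nat) : R :=
  match t, k with
  | O, O => 1
  | O, S _ => 0
  | S t', O => q * binp p q t' O
  | S t', S k' => p * binp p q t' k' + q * binp p q t' (S k')
  end.

(** The probability that the binomial variable is strictly larger than [k]. With it, [meanh J t k]
    is [J + 1] times the mean of the positive part of the variable minus [k]. *)
Fixpoint bintail (p q : R) (t k : nat) : R :=
  match t, k with
  | O, _ => 0
  | S t', O => p + q * bintail p q t' O
  | S t', S k' => p * bintail p q t' k' + q * bintail p q t' (S k')
  end.

Lemma bintail_0 p q t : p + q = 1 -> bintail p q t 0 = 1 - binp p q t 0.
Proof.
  intros H. induction t as [|t IH]; simpl; [ring|]. rewrite IH. replace p with (1 - q) by lra. ring.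
Qed.

Lemma bintail_diff p q t k : p + q = 1 ->
  bintail p q t k - bintail p q t (S k) = binp p q t (S k).
Proof.
  intros H. revert k. induction t as [|t IH]; intros k; [simpl; ring|].
  destruct k as [|k]; cbn [bintail binp].
  - rewrite <- (IH 0%nat). rewrite (bintail_0 p q t H). ring.
  - rewrite <- !IH. ring.
Qed.

Lemma binp_0 p q t : binp p q t 0 = q ^ t.
Proof. induction t as [|t IH]; simpl; [reflexivity | now rewrite IH]. Qed.

Lemma binp_1 p q t : q * binp p q t 1 = INR t * p * q ^ t.
Proof.
  induction t as [|t IH]; [simpl; ring|].
  cbn [binp]. rewrite binp_0, Rmult_plus_distr_l, IH, S_INR. simpl. ring.
Qed.

Lemma binp_out p q t k : (t < k)%nat -> binp p q t k = 0.
Proof.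
  revert k. induction t as [|t IH]; intros [|k] Hk; try lia; [reflexivity|].
  cbn [binp]. rewrite !IH by lia. ring.
Qed.

Lemma binp_fact p q k j :
  binp p q (k + j) k * (INR (fact k) * INR (fact j)) = INR (fact (k + j)) * p ^ k * q ^ j.
Proof.
  remember (k + j)%nat as t eqn:Et. revert k j Et. induction t as [|t IH]; intros k j Et.
  - assert (k = O /\ j = O) as [-> ->] by lia. simpl. ring.
  - destruct k as [|k].
    + simpl in Et. subst j. rewrite binp_0. simpl pow. simpl (fact 0). simpl (INR 1). ring.
    + cbn [binp]. change (fact (S k)) with (S k * fact k)%nat. change (fact (S t)) with (S t * fact t)%nat.
      rewrite !mult_INR. pose proof (IH k j ltac:(lia)) as E1.
      destruct j as [|j].
      * rewrite (binp_out p q t (S k)) by lia. assert (t = k) by lia. subst t.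
        replace ((p * binp p q k k + q * 0) * (INR (S k) * INR (fact k) * INR (fact 0)))
          with (p * INR (S k) * (binp p q k k * (INR (fact k) * INR (fact 0)))) by ring.
        rewrite E1. simpl pow. ring.
      * pose proof (IH (S k) j ltac:(lia)) as E2.
        change (fact (S k)) with (S k * fact k)%nat in E2.
        change (fact (S j)) with (S j * fact j)%nat in *. rewrite !mult_INR in *.
        replace ((p * binp p q t k + q * binp p q t (S k)) * (INR (S k) * INR (fact k) * (INR (S j) * INR (fact j))))
          with (p * INR (S k) * (binp p q t k * (INR (fact k) * (INR (S j) * INR (fact j))))
             + q * INR (S j) * (binp p q t (S k) * (INR (S k) * INR (fact k) * INR (fact j)))) by ring.
        rewrite E1, E2. replace (INR (S t)) with (INR (S k) + INR (S j)).
        -- simpl pow. ring.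
        -- rewrite <- plus_INR. f_equal. lia.
Qed.

(* De Moivre's formula for the truncated mean of a binomial variable. *)
Lemma meanh_binomial J t k :
  let p := INR J / (INR J + 1) in let q := / (INR J + 1) in
  meanh J t k = (INR J + 1) *
    ((INR k + 1) * q * binp p q t (S k) + (INR t * p - INR k) * bintail p q t k).
Proof.
  intros p q. pose proof (J1_pos J) as HJ.
  assert (Hpq : p + q = 1) by (unfold p, q; field; lra).
  revert k. induction t as [|t IH]; intros k.
  - rewrite meanh_init. simpl. ring.
  - destruct k as [|k].
    + rewrite meanh_0, (bintail_0 p q (S t) Hpq), binp_0.
      simpl (INR 0). rewrite Rplus_0_l, Rmult_1_l, binp_1.
      replace ((INR J + 1) * (INR (S t) * p * q ^ S t + (INR (S t) * p - 0) * (1 - q ^ S t)))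
        with ((INR J + 1) * p * INR (S t)) by ring.
      unfold p. field. lra.
    + rewrite meanh_S, !IH. fold p q. cbn [bintail binp].
      rewrite !S_INR. rewrite <- (bintail_diff p q t k Hpq).
      replace q with (1 - p) by lra. ring.
Qed.

(** At these times and positions the binomial mean [t p] equals [k], so the tail term of de Moivre's
    formula disappears and a single point probability remains. *)
Lemma meanh_central J l : (1 <= l)%nat ->
  meanh J ((J + 1) * l) (J * l) = INR J * INR l * (INR J / (INR J + 1)) ^ (J * l) * (/ (INR J + 1)) ^ l
    * INR (fact ((J + 1) * l)) / (INR (fact (J * l)) * INR (fact l)).
Proof.
  intros Hl. rewrite meanh_binomial. pose proof (J1_pos J) as HJ.
  set (p := INR J / (INR J + 1)). set (q := / (INR J + 1)).
  replace (INR ((J + 1) * l) * p - INR (J * l)) with 0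
    by (unfold p; rewrite !mult_INR, plus_INR; simpl; field; lra).
  rewrite Rmult_0_l, Rplus_0_r. destruct l as [|l']; [lia|].
  pose proof (binp_fact p q (S (J * S l')) l') as E.
  replace (S (J * S l') + l')%nat with ((J + 1) * S l')%nat in E by lia.
  change (fact (S (J * S l'))) with (S (J * S l') * fact (J * S l'))%nat in E.
  change (fact (S l')) with (S l' * fact l')%nat. rewrite !mult_INR in *.
  assert (F1 : 0 < INR (fact (J * S l'))) by (apply lt_0_INR, lt_O_fact).
  assert (F2 : 0 < INR (fact l')) by (apply lt_0_INR, lt_O_fact).
  assert (F3 : 0 < INR (S (J * S l'))) by (apply lt_0_INR; lia).
  assert (F4 : 0 < INR (S l')) by (apply lt_0_INR; lia).
  set (b := binp _ _ _ _) in *. set (F := INR (fact ((J + 1) * S l'))) in *.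
  assert (Eb : b = F * p ^ S (J * S l') * q ^ l' / (INR (S (J * S l')) * INR (fact (J * S l')) * INR (fact l'))).
  { rewrite <- E. field. repeat split; lra. }
  replace (INR J * INR (S l') + 1) with (INR (S (J * S l'))) by (rewrite S_INR, mult_INR; reflexivity).
  rewrite Eb, <- !tech_pow_Rmult.
  set (u := p ^ (J * S l')). set (v := q ^ l'). unfold p, q. field. repeat split; lra.
Qed.

(** Written through [stirling_log], all terms growing with [l] cancel. What remains is [D l], with
    limit [- ln (2 PI) / 2], and the constant [ln (J (J + 1)) / 2]. *)
Lemma meanh_central_limit J : (1 <= J)%nat ->
  is_lim_seq (fun l => meanh J ((J + 1) * l) (J * l) / sqrt (INR l))
    (sqrt (INR J * (INR J + 1) / (2 * PI))).
Proof.
  intros HJ1. assert (HJ : 1 <= INR J) by (apply (le_INR 1); lia). pose proof PI_RGT_0 as HPI.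
  set (D := fun l => stirling_log ((J + 1) * l) - stirling_log (J * l) - stirling_log l).
  apply is_lim_seq_ext_loc with (u := fun l => exp (D l + ln (INR J * (INR J + 1)) / 2)).
  - exists 1%nat. intros l Hl. assert (Hl1 : 1 <= INR l) by (apply (le_INR 1); lia).
    rewrite meanh_central by assumption.
    assert (F1 : 0 < INR (fact (J * l))) by (apply lt_0_INR, lt_O_fact).
    assert (F2 : 0 < INR (fact l)) by (apply lt_0_INR, lt_O_fact).
    assert (F3 : 0 < INR (fact ((J + 1) * l))) by (apply lt_0_INR, lt_O_fact).
    rewrite <- !exp_INR_ln by (try apply Rdiv_lt_0_compat; try apply Rinv_0_lt_compat; lra).
    rewrite <- Rpower_sqrt by lra. unfold Rpower.
    transitivity (exp (ln (INR J) + ln (INR l) + INR (J * l) * ln (INR J / (INR J + 1))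
      + INR l * ln (/ (INR J + 1)) + ln (INR (fact ((J + 1) * l)))
      + - (ln (INR (fact (J * l))) + ln (INR (fact l))) + - (/ 2 * ln (INR l)))).
    + f_equal. rewrite ln_Rinv, ln_div by lra. unfold D, stirling_log.
      rewrite !mult_INR, plus_INR. simpl (INR 1). rewrite !ln_mult by lra. field.
    + rewrite !exp_plus, !exp_Ropp, !exp_plus, !exp_ln by lra. reflexivity.
  - replace (sqrt (INR J * (INR J + 1) / (2 * PI))) with
      (exp (ln (2 * PI) / 2 - ln (2 * PI) / 2 - ln (2 * PI) / 2 + ln (INR J * (INR J + 1)) / 2)).
    + apply is_lim_seq_exp. apply is_lim_seq_plus'; [|apply is_lim_seq_const].
      unfold D. apply is_lim_seq_minus'; [apply is_lim_seq_minus'|].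
      * apply (is_lim_seq_mul_index stirling_log _ (J + 1)); [lia | apply stirling].
      * apply (is_lim_seq_mul_index stirling_log _ J); [lia | apply stirling].
      * apply stirling.
    + assert (0 < INR J * (INR J + 1)) by nra.
      rewrite <- Rpower_sqrt by (apply Rdiv_lt_0_compat; lra). unfold Rpower.
      rewrite ln_div by lra. f_equal. field.
Qed.

(** * The Gamma distribution *)

(** The Gamma kernel with [p = a - 1]. Here [a > 1], so for [p > 0] the extension by zero is
    continuous on the whole line and integrals from 0 are proper at the lower end. *)
Definition gker (p x : R) : R := if Rlt_dec 0 x then Rpower x p * exp (- x) else 0.

Lemma gker_pos p x : 0 < x -> gker p x = Rpower x p * exp (- x).
Proof. intros H. unfold gker. destruct (Rlt_dec 0 x); [reflexivity | lra]. Qed.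

Lemma gker_neg p x : x <= 0 -> gker p x = 0.
Proof. intros H. unfold gker. destruct (Rlt_dec 0 x); [lra | reflexivity]. Qed.

Lemma gker_nonneg p x : 0 <= gker p x.
Proof.
  destruct (Rlt_dec 0 x).
  - rewrite gker_pos by assumption. apply Rmult_le_pos; apply Rlt_le; apply exp_pos.
  - rewrite gker_neg; lra.
Qed.

Lemma gker_succ p x : gker (p + 1) x = x * gker p x.
Proof.
  destruct (Rlt_dec 0 x).
  - rewrite !gker_pos by assumption. rewrite Rpower_plus, Rpower_1 by assumption. ring.
  - rewrite !gker_neg by lra. ring.
Qed.

Lemma is_derive_gker_pos p x : 0 < x -> is_derive (gker (p + 1)) x ((p + 1) * gker p x - gker (p + 1) x).
Proof.
  intros Hx. apply (is_derive_ext_loc (fun y => exp ((p + 1) * ln y) * exp (- y))).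
  - exists (mkposreal x Hx). intros y Hy.
    assert (Hy' : Rabs (y - x) < x) by exact Hy. apply Rabs_def2 in Hy'. rewrite gker_pos by lra. reflexivity.
  - auto_derive; [assumption|]. rewrite !gker_pos by assumption.
    rewrite (Rpower_plus p 1), Rpower_1 by assumption.
    replace (exp ((p + 1) * ln x)) with (Rpower x p * x)
      by (rewrite <- (Rpower_1 x) at 2 by assumption; rewrite <- Rpower_plus; reflexivity).
    field. lra.
Qed.

Lemma continuous_gker p x : 0 < p -> continuous (gker p) x.
Proof.
  intros Hp. destruct (Rtotal_order x 0) as [Hx|[->|Hx]].
  - apply (continuous_ext_loc (gker p) (fun _ => 0) x); [|apply continuous_const].
    assert (Hx' : 0 < - x) by lra. exists (mkposreal (- x) Hx'). intros y Hy.
    assert (Hy' : Rabs (y - x) < - x) by exact Hy. apply Rabs_def2 in Hy'. rewrite gker_neg by lra. reflexivity.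
  - intros P HP. rewrite gker_neg in HP by lra. destruct HP as (e & He).
    (* For positive [y] the kernel is at most [y^p], which stays below [e] as long as
       [y < e^(1/p)]. *)
    assert (Hd : 0 < Rpower e (/ p)) by apply exp_pos.
    exists (mkposreal _ Hd). intros y Hy. apply He.
    assert (Hy' : Rabs (y - 0) < Rpower e (/ p)) by exact Hy. rewrite Rminus_0_r in Hy'.
    change (Rabs (gker p y - 0) < e). rewrite Rminus_0_r, Rabs_pos_eq by apply gker_nonneg.
    destruct (Rlt_dec 0 y) as [H|H].
    + rewrite gker_pos by assumption. rewrite Rabs_pos_eq in Hy' by lra.
      apply Rle_lt_trans with (Rpower y p * 1).
      * apply Rmult_le_compat_l; [apply Rlt_le, exp_pos|]. rewrite <- exp_0. apply exp_mono. lra.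
      * rewrite Rmult_1_r. apply Rlt_le_trans with (Rpower (Rpower e (/ p)) p).
        -- unfold Rpower at 1 2. apply exp_increasing, Rmult_lt_compat_l; [assumption|].
           apply ln_increasing; assumption.
        -- rewrite Rpower_mult, Rinv_l, Rpower_1 by (try apply cond_pos; lra). lra.
    + rewrite gker_neg by lra. apply cond_pos.
  - replace p with (p - 1 + 1) by ring. apply (ex_derive_continuous (gker (p - 1 + 1))).
    eexists. apply is_derive_gker_pos, Hx.
Qed.

Lemma ex_RInt_gker p a b : 0 < p -> ex_RInt (gker p) a b.
Proof.
  intros Hp. apply (ex_RInt_continuous (V := R_CompleteNormedModule)).
  intros. now apply continuous_gker.
Qed.

(** At the origin the difference quotient of [gker (p + 1)] is [gker p h], so the derivative there
    is continuity of [gker p]. *)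
Lemma is_derive_gker p x : 0 < p -> 0 <= x ->
  is_derive (gker (p + 1)) x ((p + 1) * gker p x - gker (p + 1) x).
Proof.
  intros Hp [Hx| <-]; [now apply is_derive_gker_pos|].
  rewrite !gker_neg by lra. replace ((p + 1) * 0 - 0) with 0 by ring.
  apply is_derive_Reals. intros e He.
  destruct (continuous_gker p 0 Hp (fun y => Rabs (y - gker p 0) < e)) as (d & Hd).
  { exists (mkposreal e He). intros y Hy. exact Hy. }
  exists d. intros h Hh Hhd.
  replace ((gker (p + 1) (0 + h) - gker (p + 1) 0) / h - 0) with (gker p h - gker p 0).
  - apply Hd. change (Rabs (h - 0) < d). now rewrite Rminus_0_r.
  - rewrite (gker_neg p 0), (gker_neg (p + 1) 0), Rplus_0_l, gker_succ by lra. field. assumption.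
Qed.

(** From [ln (x / (2 p)) <= x / (2 p)] one gets [p ln x <= p ln (2 p) + x / 2], which spends half of
    the exponential decay on the power. *)
Lemma gker_bound p x : 0 < p -> 0 <= x -> gker p x <= exp (p * ln (2 * p)) * exp (- (x / 2)).
Proof.
  intros Hp [Hx| <-].
  - rewrite gker_pos by assumption. unfold Rpower. rewrite <- !exp_plus. apply exp_mono.
    assert (H : ln (x / (2 * p)) <= x / (2 * p)).
    { rewrite <- (ln_exp (x / (2 * p))) at 2. apply ln_le; [apply Rdiv_lt_0_compat; lra|].
      pose proof (exp_ineq1_le (x / (2 * p))). lra. }
    rewrite ln_div in H by lra.
    assert (p * (ln x - ln (2 * p)) <= p * (x / (2 * p))) by (apply Rmult_le_compat_l; lra).
    replace (p * (x / (2 * p))) with (x / 2) in H0 by (field; lra). lra.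
  - rewrite gker_neg by lra. apply Rmult_le_pos; apply Rlt_le, exp_pos.
Qed.

Lemma exp_half_small e : 0 < e -> exists M0, 0 <= M0 /\ forall M, M0 <= M -> exp (- (M / 2)) < e.
Proof.
  intros He. exists (2 / e). split; [apply Rdiv_le_0_compat; lra|]. intros M HM.
  assert (HM0 : 0 < M) by (pose proof (Rdiv_lt_0_compat 2 e ltac:(lra) He); lra).
  rewrite exp_Ropp. rewrite <- (Rinv_inv e). apply Rinv_lt_contravar.
  - apply Rmult_lt_0_compat; [apply Rinv_0_lt_compat, He | apply exp_pos].
  - pose proof (exp_ineq1_le (M / 2)).
    assert (/ e <= M / 2) by (apply Rle_div_r; [lra|]; replace (/ e * 2) with (2 / e) by (unfold Rdiv; ring); exact HM).
    lra.
Qed.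

Definition integral_to (f : R -> R) (L : R) : Prop :=
  forall e, 0 < e -> exists M0, 0 <= M0 /\ forall M, M0 <= M -> Rabs (RInt f 0 M - L) < e.

(** The partial integrals increase and are bounded through [gker_bound], so they converge to their
    supremum. *)
Lemma gker_integral p : 0 < p -> exists G, 0 < G /\ integral_to (gker p) G.
Proof.
  intros Hp. set (C := exp (p * ln (2 * p))). assert (HC : 0 < C) by apply exp_pos.
  assert (Hmono : forall x y, 0 <= x <= y -> RInt (gker p) 0 x <= RInt (gker p) 0 y).
  { intros x y Hxy.
    rewrite <- (RInt_Chasles (V := R_CompleteNormedModule) (gker p) 0 x y) by now apply ex_RInt_gker.
    assert (0 <= RInt (gker p) x y).
    { apply RInt_ge_0; [lra | now apply ex_RInt_gker | intros; apply gker_nonneg]. }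
    unfold plus; simpl. lra. }
  assert (Hub : forall x, 0 <= x -> RInt (gker p) 0 x <= 2 * C).
  { intros x Hx.
    assert (I : is_RInt (fun y => C * exp (- (y / 2))) 0 x (-2 * C * exp (- (x / 2)) - -2 * C * exp (- (0 / 2)))).
    { apply (is_RInt_derive (fun y => -2 * C * exp (- (y / 2)))).
      - intros y _. auto_derive; [auto|]. unfold Rdiv. field.
      - intros y _. apply (ex_derive_continuous (fun y => C * exp (- (y / 2)))). auto_derive. auto. }
    apply Rle_trans with (RInt (fun y => C * exp (- (y / 2))) 0 x).
    - apply RInt_le; [assumption | now apply ex_RInt_gker | eexists; exact I |].
      intros y Hy. apply gker_bound; lra.
    - rewrite (is_RInt_unique (V := R_CompleteNormedModule) _ _ _ _ I).
      replace (- (0 / 2)) with 0 by field. rewrite exp_0.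
      assert (0 < C * exp (- (x / 2))) by (apply Rmult_lt_0_compat; [assumption | apply exp_pos]). lra. }
  destruct (completeness (fun y => exists x, 0 <= x /\ y = RInt (gker p) 0 x)) as (G & HG1 & HG2).
  - exists (2 * C). intros y (x & Hx & ->). now apply Hub.
  - exists (RInt (gker p) 0 0), 0. split; [lra | reflexivity].
  - exists G. split.
    + apply Rlt_le_trans with (RInt (gker p) 0 1).
      * apply RInt_gt_0; [lra | | intros; now apply continuous_gker].
        intros x Hx. rewrite gker_pos by lra. apply Rmult_lt_0_compat; apply exp_pos.
      * apply HG1. exists 1. split; [lra | reflexivity].
    + intros e He. destruct (Classical_Prop.classic (exists x, 0 <= x /\ G - e < RInt (gker p) 0 x)) as [(x & Hx & Hl)|Hn].
      * exists x. split; [assumption|]. intros M HM.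
        pose proof (Hmono x M ltac:(lra)).
        assert (RInt (gker p) 0 M <= G) by (apply HG1; exists M; split; [lra | reflexivity]).
        apply Rabs_def1; lra.
      * exfalso. assert (G <= G - e); [|lra]. apply HG2. intros y (x & Hx & ->).
        apply Rnot_lt_le. intros Hlt. apply Hn. exists x. auto.
Qed.

Lemma integral_to_ext f g L : (forall x, f x = g x) -> integral_to f L -> integral_to g L.
Proof.
  intros H Hf e He. destruct (Hf e He) as (M0 & H0 & HM). exists M0. split; [assumption|].
  intros M HM'. rewrite <- (RInt_ext f) by (intros; apply H). auto.
Qed.

(** The functional equation of the Gamma function: integrating the derivative of [gker (p + 1)] is
    integration by parts, and the boundary term at [M] decays exponentially. *)
Lemma integral_gker_succ p G : 0 < p -> integral_to (gker p) G -> integral_to (gker (p + 1)) ((p + 1) * G).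
Proof.
  intros Hp HG e He. set (C := exp ((p + 1) * ln (2 * (p + 1)))).
  assert (HC : 0 < C) by apply exp_pos.
  destruct (HG (e / 2 / (p + 1))) as (M1 & H1 & HM1); [repeat apply Rdiv_lt_0_compat; lra|].
  destruct (exp_half_small (e / 2 / C)) as (M2 & H2 & HM2); [repeat apply Rdiv_lt_0_compat; lra|].
  exists (Rmax M1 M2). split; [eapply Rle_trans; [exact H1 | apply Rmax_l]|]. intros M HM.
  assert (HMa : M1 <= M) by (eapply Rle_trans; [apply Rmax_l | exact HM]).
  assert (HMb : M2 <= M) by (eapply Rle_trans; [apply Rmax_r | exact HM]).
  specialize (HM1 M HMa). specialize (HM2 M HMb).
  assert (I : is_RInt (fun x => (p + 1) * gker p x - gker (p + 1) x) 0 M (gker (p + 1) M - gker (p + 1) 0)).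
  { apply (is_RInt_derive (gker (p + 1))).
    - intros x Hx. rewrite Rmin_left in Hx by lra. apply is_derive_gker; [assumption | apply Hx].
    - intros x _. apply (continuous_minus (fun x => (p + 1) * gker p x) (gker (p + 1))).
      + apply (continuous_mult (fun _ => p + 1) (gker p)); [apply continuous_const | now apply continuous_gker].
      + apply continuous_gker. lra. }
  apply (is_RInt_unique (V := R_CompleteNormedModule)) in I.
  rewrite (RInt_minus (V := R_CompleteNormedModule) (fun x => (p + 1) * gker p x) (gker (p + 1))) in I.
  - rewrite (RInt_scal (V := R_CompleteNormedModule) (gker p)) in I by now apply ex_RInt_gker.
    unfold minus, plus, opp, scal in I; simpl in I; unfold mult in I; simpl in I.
    rewrite (gker_neg (p + 1) 0) in I by lra.
    pose proof (gker_bound (p + 1) M ltac:(lra) ltac:(lra)) as Hb. fold C in Hb.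
    pose proof (gker_nonneg (p + 1) M).
    assert (C * exp (- (M / 2)) < e / 2).
    { apply Rlt_le_trans with (C * (e / 2 / C)); [apply Rmult_lt_compat_l; assumption|]. right. field. lra. }
    replace (RInt (gker (p + 1)) 0 M - (p + 1) * G) with
      ((p + 1) * (RInt (gker p) 0 M - G) - gker (p + 1) M) by lra.
    unfold Rminus at 1. eapply Rle_lt_trans; [apply Rabs_triang|].
    rewrite Rabs_Ropp, (Rabs_pos_eq (gker _ _)) by assumption.
    rewrite Rabs_mult, (Rabs_pos_eq (p + 1)) by lra.
    assert ((p + 1) * Rabs (RInt (gker p) 0 M - G) < (p + 1) * (e / 2 / (p + 1)))
      by (apply Rmult_lt_compat_l; lra).
    replace ((p + 1) * (e / 2 / (p + 1))) with (e / 2) in H3 by (field; lra). lra.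
  - apply (ex_RInt_scal (V := R_CompleteNormedModule) (gker p)). now apply ex_RInt_gker.
  - apply ex_RInt_gker. lra.
Qed.

Lemma integral_gker_poch p G m : 0 < p -> integral_to (gker p) G ->
  integral_to (gker (p + INR m)) (poch (p + 1) m * G).
Proof.
  intros Hp HG. induction m as [|m IH].
  - simpl. rewrite Rplus_0_r, Rmult_1_l. exact HG.
  - rewrite S_INR. replace (p + (INR m + 1)) with (p + INR m + 1) by ring.
    replace (poch (p + 1) (S m) * G) with ((p + INR m + 1) * (poch (p + 1) m * G)) by (simpl; ring).
    apply integral_gker_succ; [pose proof (pos_INR m); lra | exact IH].
Qed.

Lemma improper_integral0_intro f L : (forall M, ex_RInt f 0 M) -> integral_to f L -> improper_integral0 f L.
Proof.
  intros Hex HL. split.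
  - intros M _. constructor. apply ex_RInt_Reals_0, Hex.
  - intros e He. destruct (HL e He) as (M0 & _ & HM). exists M0. intros M pr HM0.
    rewrite <- RInt_Reals. now apply HM.
Qed.

(** The substitution [y = b x]: the power [x^m] merges with the density into a kernel of higher
    exponent, and the normalisation becomes [G b^m]. *)
Lemma gamma_density_gker a b G m x : 0 < b -> G <> 0 ->
  x ^ m * gamma_density a b G x = / (G * b ^ m) * (b * gker (a - 1 + INR m) (b * x)).
Proof.
  intros Hb HG. unfold gamma_density. destruct (Rlt_dec 0 x) as [Hx|Hx].
  - rewrite gker_pos by (apply Rmult_lt_0_compat; assumption).
    rewrite Rpower_plus, Rpower_pow by (apply Rmult_lt_0_compat; assumption).
    rewrite <- Rpower_mult_distr, Rpow_mult_distr by assumption.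
    replace (Rpower b a) with (Rpower b (a - 1) * b)
      by (rewrite <- (Rpower_1 b) at 2 by assumption; rewrite <- Rpower_plus; f_equal; ring).
    field. split; [apply pow_nonzero; lra | assumption].
  - rewrite gker_neg by nra. ring.
Qed.

Theorem gamma_moment a b m : 1 < a -> 0 < b ->
  exists G, improper_integral0 (gamma_kernel a) G /\
    improper_integral0 (fun x => x ^ m * gamma_density a b G x) (poch a m / b ^ m).
Proof.
  intros Ha Hb. set (p := a - 1). assert (Hp : 0 < p) by (unfold p; lra).
  destruct (gker_integral p Hp) as (G & HG & HI).
  assert (Hpm : 0 < p + INR m) by (pose proof (pos_INR m); lra).
  exists G. split.
  - apply improper_integral0_intro; [intros; now apply ex_RInt_gker | exact HI].
  - set (f := fun x => / (G * b ^ m) * (b * gker (p + INR m) (b * x))).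
    assert (Ef : forall x, f x = x ^ m * gamma_density a b G x)
      by (intros; unfold f; rewrite gamma_density_gker by lra; reflexivity).
    assert (Hbm : 0 < b ^ m) by now apply pow_lt.
    assert (Hex : forall M, is_RInt f 0 M (/ (G * b ^ m) * RInt (gker (p + INR m)) 0 (b * M))).
    { intros M. apply (is_RInt_scal (V := R_NormedModule) (fun x => b * gker (p + INR m) (b * x))).
      apply (is_RInt_ext (fun x => scal b (gker (p + INR m) (b * x + 0)))).
      - intros x _. rewrite Rplus_0_r. reflexivity.
      - apply (is_RInt_comp_lin (V := R_NormedModule) (gker (p + INR m)) b 0 0 M).
        rewrite Rmult_0_r, !Rplus_0_r.
        apply (RInt_correct (V := R_CompleteNormedModule)). now apply ex_RInt_gker. }
    apply improper_integral0_intro.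
    + intros M. apply (ex_RInt_ext f); [intros; apply Ef|]. eexists; apply Hex.
    + apply (integral_to_ext f); [exact Ef|].
      intros e He. pose proof (integral_gker_poch p G m Hp HI) as HP.
      replace (p + 1) with a in HP by (unfold p; ring).
      destruct (HP (e * (G * b ^ m))) as (M0 & H0 & HM); [repeat apply Rmult_lt_0_compat; assumption|].
      exists (M0 / b). split; [apply Rdiv_le_0_compat; assumption|]. intros M HMb.
      rewrite (is_RInt_unique (V := R_CompleteNormedModule) _ _ _ _ (Hex M)).
      assert (HbM : M0 <= b * M) by (apply Rle_div_l in HMb; [lra | assumption]).
      specialize (HM _ HbM). assert (HGb : 0 < G * b ^ m) by (apply Rmult_lt_0_compat; assumption).
      replace (/ (G * b ^ m) * RInt (gker (p + INR m)) 0 (b * M) - poch a m / b ^ m)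
        with (/ (G * b ^ m) * (RInt (gker (p + INR m)) 0 (b * M) - poch a m * G)) by (field; lra).
      rewrite Rabs_mult, Rabs_pos_eq by (apply Rlt_le, Rinv_0_lt_compat; assumption).
      apply (Rmult_lt_reg_l (G * b ^ m)); [assumption|].
      rewrite <- Rmult_assoc, Rinv_r, Rmult_1_l by lra. lra.
Qed.

(** * Passage to the limit *)

Definition tends (f : R -> R) (L : R) : Prop :=
  forall eps, 0 < eps -> exists M, forall T, M < T -> Rabs (f T - L) < eps.

Definition eventually_T (P : R -> Prop) : Prop := exists M, forall T, M < T -> P T.

Lemma eventually_T_and P Q : eventually_T P -> eventually_T Q -> eventually_T (fun T => P T /\ Q T).
Proof.
  intros (M1 & H1) (M2 & H2). exists (Rmax M1 M2). intros T HT.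
  pose proof (Rmax_l M1 M2). pose proof (Rmax_r M1 M2). split; [apply H1 | apply H2]; lra.
Qed.

Lemma eventually_T_imp (P Q : R -> Prop) : (forall T, P T -> Q T) -> eventually_T P -> eventually_T Q.
Proof. intros H (M & HM). exists M. auto. Qed.

Lemma tends_lim f L : tends f L <-> is_lim f p_infty L.
Proof.
  split.
  - intros H. apply is_lim_spec. intros e. apply H, cond_pos.
  - intros H e He. apply is_lim_spec in H. destruct (H (mkposreal e He)) as (M & HM). exists M. exact HM.
Qed.

Lemma tends_const c : tends (fun _ => c) c.
Proof. intros e He. exists 0. intros. now rewrite Rminus_diag, Rabs_R0. Qed.

Lemma tends_plus f g a b : tends f a -> tends g b -> tends (fun T => f T + g T) (a + b).
Proof. rewrite !tends_lim. intros H1 H2. now apply is_lim_plus'. Qed.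

Lemma tends_mult f g a b : tends f a -> tends g b -> tends (fun T => f T * g T) (a * b).
Proof.
  rewrite !tends_lim. intros H1 H2. exact (is_lim_mult f g p_infty a b H1 H2 I).
Qed.

Lemma tends_pow f a m : tends f a -> tends (fun T => f T ^ m) (a ^ m).
Proof. intros H. induction m as [|m IH]; [exact (tends_const 1) | exact (tends_mult _ _ _ _ H IH)]. Qed.

Lemma tends_sqrt f a : tends f a -> tends (fun T => sqrt (f T)) (sqrt a).
Proof.
  rewrite !tends_lim. intros H. apply (is_lim_comp_continuous f sqrt p_infty a H).
  apply continuous_sqrt.
Qed.

Lemma tends_ext f g a : eventually_T (fun T => f T = g T) -> tends f a -> tends g a.
Proof.
  intros He Hf e Hpos. specialize (Hf e Hpos).
  eapply eventually_T_imp; [|exact (eventually_T_and _ _ He Hf)].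
  intros T [E H]. now rewrite <- E.
Qed.

Lemma tends_squeeze f g a : tends g a -> forall d, tends d 0 ->
  eventually_T (fun T => Rabs (f T - g T) <= d T) -> tends f a.
Proof.
  intros Hg d Hd He e Hpos.
  pose proof (Hg (e / 2) ltac:(lra)) as H1. pose proof (Hd (e / 2) ltac:(lra)) as H2.
  eapply eventually_T_imp; [|exact (eventually_T_and _ _ He (eventually_T_and _ _ H1 H2))].
  intros T (A & B & C). replace (f T - a) with ((f T - g T) + (g T - a)) by ring.
  eapply Rle_lt_trans; [apply Rabs_triang|]. rewrite Rminus_0_r in C.
  pose proof (Rle_abs (d T)). lra.
Qed.

Lemma Rpower_quarter_large A : eventually_T (fun T => 0 < T /\ A < Rpower T (1 / 4)).
Proof.
  set (B := Rmax A 1). exists (B ^ 4). intros T HT.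
  assert (HB : 1 <= B) by apply Rmax_r. assert (HA : A <= B) by apply Rmax_l.
  assert (0 < B ^ 4) by (apply pow_lt; lra). split; [lra|].
  apply Rle_lt_trans with B; [assumption|].
  replace B with (Rpower (B ^ 4) (1 / 4)) at 1.
  - unfold Rpower. apply exp_increasing, Rmult_lt_compat_l; [lra|]. apply ln_increasing; assumption.
  - rewrite <- Rpower_pow by lra. rewrite Rpower_mult.
    replace (INR 4 * (1 / 4)) with 1 by (simpl; field). apply Rpower_1. lra.
Qed.

Lemma Rpower_quarter_4 T : 0 < T -> Rpower T (1 / 4) ^ 4 = T.
Proof.
  intros HT. rewrite <- Rpower_pow by apply exp_pos. rewrite Rpower_mult.
  replace (1 / 4 * INR 4) with 1 by (simpl; field). now apply Rpower_1.
Qed.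

Lemma Rpower_quarter_2 T : 0 < T -> Rpower T (1 / 4) ^ 2 = sqrt T.
Proof.
  intros HT. rewrite <- (Rpower_quarter_4 T HT) at 2.
  replace (Rpower T (1 / 4) ^ 4) with (Rpower T (1 / 4) ^ 2 * Rpower T (1 / 4) ^ 2) by ring.
  rewrite sqrt_square; [reflexivity | apply pow2_ge_0].
Qed.

Lemma tends_inv_quarter c : tends (fun T => c / Rpower T (1 / 4)) 0.
Proof.
  intros e He. destruct (Rpower_quarter_large (Rabs c / e)) as (M & HM). exists M. intros T HT.
  destruct (HM T HT) as [_ H]. rewrite Rminus_0_r.
  assert (Hp : 0 < Rpower T (1 / 4)) by apply exp_pos.
  unfold Rdiv. rewrite Rabs_mult, (Rabs_pos_eq (/ _)) by (apply Rlt_le, Rinv_0_lt_compat, Hp).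
  apply Rlt_div_l; [assumption|]. apply Rlt_div_l in H; [|assumption]. lra.
Qed.

Lemma Int_part_nat x : 0 <= x ->
  INR (Z.to_nat (Int_part x)) <= x < INR (Z.to_nat (Int_part x)) + 1.
Proof.
  intros Hx. destruct (base_Int_part x) as [H1 H2].
  assert (H : (0 <= Int_part x)%Z).
  { apply Z.lt_pred_le, lt_IZR. unfold Z.pred. rewrite plus_IZR. simpl. lra. }
  rewrite INR_IZR_INZ, Z2Nat.id by assumption. lra.
Qed.

(** * Asymptotics of the mean *)

Lemma meanh_lip_k J t k d : Rabs (meanh J t (k + d) - meanh J t k) <= (INR J + 1) * INR d.
Proof.
  induction d as [|d IH].
  - rewrite Nat.add_0_r, Rminus_diag, Rabs_R0. simpl. lra.
  - rewrite Nat.add_succ_r, S_INR. pose proof (meanh_decr J t (k + d)).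
    replace (meanh J t (S (k + d)) - meanh J t k) with
      ((meanh J t (S (k + d)) - meanh J t (k + d)) + (meanh J t (k + d) - meanh J t k)) by ring.
    eapply Rle_trans; [apply Rabs_triang|].
    assert (Rabs (meanh J t (S (k + d)) - meanh J t (k + d)) <= INR J + 1) by (apply Rabs_le; lra).
    lra.
Qed.

Lemma meanh_time_step J t k : 0 <= meanh J (S t) k - meanh J t k <= INR J + 1.
Proof.
  pose proof (J1_pos J) as HJ. pose proof (pos_INR J).
  destruct k as [|k].
  - rewrite !meanh_0, S_INR. lra.
  - rewrite meanh_S. pose proof (meanh_decr J t k) as D. set (p := INR J / (INR J + 1)).
    assert (Hp : 0 <= p <= 1).
    { unfold p. split; [apply Rdiv_le_0_compat; lra | apply Rle_div_l; lra]. }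
    replace (/ (INR J + 1)) with (1 - p) by (unfold p; field; lra).
    replace (p * meanh J t k + (1 - p) * meanh J t (S k) - meanh J t (S k))
      with (p * (meanh J t k - meanh J t (S k))) by ring. nra.
Qed.

Lemma meanh_lip_t J t d k : Rabs (meanh J (t + d) k - meanh J t k) <= (INR J + 1) * INR d.
Proof.
  induction d as [|d IH].
  - rewrite Nat.add_0_r, Rminus_diag, Rabs_R0. simpl. lra.
  - rewrite Nat.add_succ_r, S_INR. pose proof (meanh_time_step J (t + d) k).
    replace (meanh J (S (t + d)) k - meanh J t k) with
      ((meanh J (S (t + d)) k - meanh J (t + d) k) + (meanh J (t + d) k - meanh J t k)) by ring.
    eapply Rle_trans; [apply Rabs_triang|].
    assert (Rabs (meanh J (S (t + d)) k - meanh J (t + d) k) <= INR J + 1) by (apply Rabs_le; lra).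
    lra.
Qed.

(** The asymptotics of the mean are computed only at the points [((J + 1) l, J l)]; this bound
    carries them to all nearby times and positions. *)
Lemma meanh_lip J t k t' k' :
  Rabs (meanh J t k - meanh J t' k') <= (INR J + 1) * (Rabs (INR t - INR t') + Rabs (INR k - INR k')).
Proof.
  assert (Hk : Rabs (meanh J t k - meanh J t k') <= (INR J + 1) * Rabs (INR k - INR k')).
  { destruct (Nat.le_ge_cases k k') as [H|H].
    - rewrite Rabs_minus_sym, (Rabs_minus_sym (INR k)), <- minus_INR, (Rabs_pos_eq (INR _))
        by (try apply pos_INR; assumption).
      pose proof (meanh_lip_k J t k (k' - k)) as G. replace (k + (k' - k))%nat with k' in G by lia. exact G.
    - rewrite <- minus_INR, (Rabs_pos_eq (INR _)) by (try apply pos_INR; assumption).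
      pose proof (meanh_lip_k J t k' (k - k')) as G. replace (k' + (k - k'))%nat with k in G by lia. exact G. }
  assert (Ht : Rabs (meanh J t k' - meanh J t' k') <= (INR J + 1) * Rabs (INR t - INR t')).
  { destruct (Nat.le_ge_cases t t') as [H|H].
    - rewrite Rabs_minus_sym, (Rabs_minus_sym (INR t)), <- minus_INR, (Rabs_pos_eq (INR _))
        by (try apply pos_INR; assumption).
      pose proof (meanh_lip_t J t (t' - t) k') as G. replace (t + (t' - t))%nat with t' in G by lia. exact G.
    - rewrite <- minus_INR, (Rabs_pos_eq (INR _)) by (try apply pos_INR; assumption).
      pose proof (meanh_lip_t J t' (t - t') k') as G. replace (t' + (t - t'))%nat with t in G by lia. exact G. }
  replace (meanh J t k - meanh J t' k') with ((meanh J t k - meanh J t k') + (meanh J t k' - meanh J t' k')) by ring.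
  eapply Rle_trans; [apply Rabs_triang|]. lra.
Qed.

Lemma tends_floor_ratio c : 0 < c ->
  tends (fun T => INR (Z.to_nat (Int_part (c * T))) / T) c.
Proof.
  intros Hc. apply tends_squeeze with (g := fun _ => c) (d := fun T => 1 / Rpower T (1 / 4)).
  - apply tends_const.
  - apply tends_inv_quarter.
  - eapply eventually_T_imp; [|apply (Rpower_quarter_large 1)]. intros T [HT HR].
    destruct (Int_part_nat (c * T)) as [H1 H2]; [apply Rmult_le_pos; lra|].
    set (l := INR _) in *. set (tau := Rpower T (1 / 4)) in *.
    replace (l / T - c) with (- ((c * T - l) / T)) by (field; lra).
    rewrite Rabs_Ropp, Rabs_pos_eq by (apply Rdiv_le_0_compat; lra).
    apply Rle_trans with (1 / T).
    + apply Rmult_le_compat_r; [apply Rlt_le, Rinv_0_lt_compat; assumption | lra].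
    + apply Rmult_le_compat_l; [lra|]. apply Rinv_le_contravar; [lra|].
      rewrite <- (Rpower_quarter_4 T HT). fold tau.
      replace tau with (tau ^ 1) at 1 by ring. apply Rle_pow; [lra | lia].
Qed.

Lemma tends_floor_seq c (f : nat -> R) (L : R) : 0 < c -> is_lim_seq f L ->
  tends (fun T => f (Z.to_nat (Int_part (c * T)))) L.
Proof.
  intros Hc Hf e He. apply is_lim_seq_spec in Hf.
  destruct (Hf (mkposreal e He)) as (N & HN). exists ((INR N + 1) / c). intros T HT.
  assert (HcT : INR N + 1 < c * T) by (apply Rlt_div_l in HT; lra).
  apply HN. apply INR_le.
  destruct (Int_part_nat (c * T)) as [H1 H2]; [pose proof (pos_INR N); lra|]. lra.
Qed.

(** The site minus one, because index [k] in [hh] and [aa] stands for the height and gap at site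
    [k + 1]. *)
Definition Hpos (J : nat) (s r T : R) : nat :=
  Z.to_nat (Int_part (INR J * r * T / (INR J + 1) + s * Rpower T (1 / 4)) - 1).

(** For large [T] the site is at least 1, so the conversion to [nat] is faithful. The error 2 in the
    position is one unit of rounding and one of index shift. *)
Lemma Hpos_spec J s r : (1 <= J)%nat -> 0 < r ->
  eventually_T (fun T => 0 < T /\ 1 < Rpower T (1 / 4) /\
    Int_part (INR J * r * T / (INR J + 1) + s * Rpower T (1 / 4)) = Z.of_nat (S (Hpos J s r T)) /\
    Rabs (INR (Hpos J s r T) - (INR J * r * T / (INR J + 1) + s * Rpower T (1 / 4))) <= 2 /\
    Rabs (INR (Htime r T) - r * T) <= 1).
Proof.
  intros HJ1 Hr. assert (HJ : 1 <= INR J) by (apply (le_INR 1); lia).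
  set (c := INR J * r / (INR J + 1)).
  assert (Hc : 0 < c) by (apply Rdiv_lt_0_compat; nra).
  (* In terms of [tau = T^(1/4)] this threshold gives [c tau^4 >= (|s| + 2) tau^3], so the linear
     term in [T] dominates [|s| tau + 2]. *)
  eapply eventually_T_imp; [|apply (Rpower_quarter_large (Rmax 1 ((Rabs s + 2) / c)))].
  intros T [HT HR]. set (tau := Rpower T (1 / 4)) in *.
  assert (H1 : 1 < tau) by (eapply Rle_lt_trans; [apply Rmax_l | exact HR]).
  assert (H2 : (Rabs s + 2) / c < tau) by (eapply Rle_lt_trans; [apply Rmax_r | exact HR]).
  split; [assumption|]. split; [assumption|].
  set (y := INR J * r * T / (INR J + 1) + s * tau).
  assert (Hy : 2 <= y).
  { unfold y. replace (INR J * r * T / (INR J + 1)) with (c * T) by (unfold c; field; lra).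
    rewrite <- (Rpower_quarter_4 T HT). fold tau.
    apply Rlt_div_l in H2; [|assumption].
    assert (- Rabs s <= s) by (pose proof (Rle_abs (- s)); rewrite Rabs_Ropp in H; lra).
    assert (1 <= tau ^ 3) by (apply pow_R1_Rle; lra).
    pose proof (Rabs_pos s).
    assert ((Rabs s + 2) * tau ^ 3 <= c * tau ^ 4).
    { replace (c * tau ^ 4) with (tau * c * tau ^ 3) by ring. apply Rmult_le_compat_r; lra. }
    assert (tau <= tau ^ 3) by (replace tau with (tau ^ 1) at 1 by ring; apply Rle_pow; [lra | lia]).
    assert (Rabs s * tau <= Rabs s * tau ^ 3) by (apply Rmult_le_compat_l; lra).
    assert (- Rabs s * tau <= s * tau) by (apply Rmult_le_compat_r; lra). lra. }
  destruct (base_Int_part y) as [B1 B2].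
  assert (HI : (1 < Int_part y + 1)%Z) by (apply lt_IZR; rewrite plus_IZR; lra).
  assert (Ek : Int_part y = Z.of_nat (S (Hpos J s r T))).
  { unfold Hpos. fold tau y. lia. }
  split; [exact Ek|]. split.
  - assert (E : INR (Hpos J s r T) = IZR (Int_part y) - 1).
    { rewrite Ek, <- INR_IZR_INZ, S_INR. ring. }
    rewrite E. apply Rabs_le. lra.
  - unfold Htime. destruct (Int_part_nat (r * T)) as [A1 A2]; [apply Rmult_le_pos; lra|].
    apply Rabs_le. lra.
Qed.

(** With [l] the integer part of [r T / (J + 1)], the point in question is within [O(T^(1/4))] of
    the central point [((J + 1) l, J l)]. By [meanh_lip] the shift, including its dependence on [s],
    is negligible against [sqrt T]. [K] adds up [|s|] and the rounding errors in time and
    position. *)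
Lemma meanh_scaling J s r : (1 <= J)%nat -> 0 < r ->
  tends (fun T => meanh J (Htime r T) (Hpos J s r T) / Rpower T (1 / 4) ^ 2)
    (sqrt (r * INR J / (2 * PI))).
Proof.
  intros HJ1 Hr. assert (HJ : 1 <= INR J) by (apply (le_INR 1); lia). pose proof PI_RGT_0 as HPI.
  set (n := INR J + 1). set (c := r / n). assert (Hc : 0 < c) by (apply Rdiv_lt_0_compat; unfold n; lra).
  set (l := fun T => Z.to_nat (Int_part (c * T))).
  set (K := n * (Rabs s + 4 + 2 * n)).
  apply tends_squeeze with
    (g := fun T => meanh J ((J + 1) * l T) (J * l T) / sqrt (INR (l T)) * sqrt (INR (l T) / T))
    (d := fun T => K / Rpower T (1 / 4)).
  - replace (sqrt (r * INR J / (2 * PI))) with (sqrt (INR J * n / (2 * PI)) * sqrt c).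
    + apply tends_mult.
      * apply (tends_floor_seq c (fun l => meanh J ((J + 1) * l) (J * l) / sqrt (INR l))); [assumption|].
        now apply meanh_central_limit.
      * apply tends_sqrt. now apply tends_floor_ratio.
    + rewrite <- sqrt_mult.
      * f_equal. unfold c, n. field. split; lra.
      * apply Rdiv_le_0_compat; [unfold n; nra | lra].
      * lra.
  - apply tends_inv_quarter.
  - assert (Hbig : eventually_T (fun T => 1 <= INR (l T))).
    { exists (2 / c). intros T HT. apply Rlt_div_l in HT; [|assumption].
      destruct (Int_part_nat (c * T)) as [H1 H2]; [lra|]. unfold l. lra. }
    eapply eventually_T_imp; [|exact (eventually_T_and _ _ Hbig (Hpos_spec J s r HJ1 Hr))].
    intros T (Hl & HT & Htau & _ & Hk & Ht). set (tau := Rpower T (1 / 4)) in *.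
    set (k := Hpos J s r T) in *. set (t := Htime r T) in *.
    assert (Hs : 0 < sqrt (INR (l T))) by (apply sqrt_lt_R0; lra).
    assert (HsT : 0 < sqrt T) by now apply sqrt_lt_R0.
    assert (E2 : tau ^ 2 = sqrt T) by now apply Rpower_quarter_2.
    rewrite sqrt_div by lra. rewrite E2.
    replace (meanh J t k / sqrt T - meanh J ((J + 1) * l T) (J * l T) / sqrt (INR (l T)) * (sqrt (INR (l T)) / sqrt T))
      with ((meanh J t k - meanh J ((J + 1) * l T) (J * l T)) / sqrt T) by (field; lra).
    unfold Rdiv at 1. rewrite Rabs_mult, (Rabs_pos_eq (/ _)) by (apply Rlt_le, Rinv_0_lt_compat, HsT).
    apply Rle_div_l; [assumption|].
    replace (K / tau * sqrt T) with (K * tau) by (rewrite <- E2; field; lra).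
    eapply Rle_trans; [apply meanh_lip|]. fold n. unfold K. rewrite Rmult_assoc.
    apply Rmult_le_compat_l; [unfold n; lra|].
    destruct (Int_part_nat (c * T)) as [H1 H2]; [apply Rmult_le_pos; lra|]. fold (l T) in H1, H2.
    rewrite !mult_INR, plus_INR. simpl (INR 1). fold n.
    assert (G1 : Rabs (INR t - n * INR (l T)) <= 1 + n).
    { replace (INR t - n * INR (l T)) with ((INR t - r * T) + n * (c * T - INR (l T)))
        by (unfold c; field; unfold n; lra).
      eapply Rle_trans; [apply Rabs_triang|]. rewrite (Rabs_pos_eq (n * _)) by (apply Rmult_le_pos; unfold n; lra).
      apply Rplus_le_compat; [assumption|]. rewrite <- (Rmult_1_r n) at 2. apply Rmult_le_compat_l; [unfold n|]; lra. }
    assert (G2 : Rabs (INR k - INR J * INR (l T)) <= 2 + Rabs s * tau + n).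
    { replace (INR k - INR J * INR (l T)) with
        ((INR k - (INR J * r * T / (INR J + 1) + s * tau)) + s * tau + INR J * (c * T - INR (l T)))
        by (unfold c, n; field; lra).
      eapply Rle_trans; [apply Rabs_triang|]. apply Rplus_le_compat.
      - eapply Rle_trans; [apply Rabs_triang|]. apply Rplus_le_compat; [assumption|].
        rewrite Rabs_mult, (Rabs_pos_eq tau); lra.
      - rewrite Rabs_pos_eq by (apply Rmult_le_pos; lra). unfold n.
        apply Rle_trans with (INR J * 1); [apply Rmult_le_compat_l; lra | lra]. }
    assert (4 + 2 * n <= (4 + 2 * n) * tau) by (rewrite <- (Rmult_1_r (4 + 2 * n)) at 1; apply Rmult_le_compat_l; unfold n; lra).
    lra.
Qed.

(** * Limits of the rescaled moments *)

Lemma ffall_moment_limit J s r m : (1 <= J)%nat -> 0 < r ->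
  tends (fun T => Einf J (Htime r T) (fun eta => ffall (hh J (Htime r T) eta (Hpos J s r T)) m)
                  / Rpower T (1 / 4) ^ (2 * m))
    (sqrt (r * INR J / (2 * PI)) ^ m).
Proof.
  intros HJ1 Hr. assert (HJ : 1 <= INR J) by (apply (le_INR 1); lia). pose proof PI_RGT_0 as HPI.
  set (c := sqrt (r * INR J / (2 * PI))).
  assert (Hc : 0 < c) by (apply sqrt_lt_R0, Rdiv_lt_0_compat; nra).
  pose proof (meanh_scaling J s r HJ1 Hr) as Hu. fold c in Hu.
  set (u := fun T => meanh J (Htime r T) (Hpos J s r T)) in *.
  assert (Hlarge : eventually_T (fun T => 2 <= u T /\ c / 2 * Rpower T (1 / 4) ^ 2 <= u T)).
  { destruct (Hu (c / 2) ltac:(lra)) as (M1 & HM1).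
    (* [tau > 4 / c] and [tau <= tau ^ 2] give [c / 2 * tau ^ 2 > 2], the threshold of the moment
       asymptotics. *)
    eapply eventually_T_imp; [|exact (eventually_T_and _ _ (ex_intro _ M1 HM1) (Rpower_quarter_large (Rmax 1 (4 / c))))].
    intros T [H1 [HT H2]]. set (tau := Rpower T (1 / 4)) in *. fold (u T) in H1.
    assert (Ht1 : 1 < tau) by (eapply Rle_lt_trans; [apply Rmax_l | exact H2]).
    assert (Ht2 : 4 / c < tau) by (eapply Rle_lt_trans; [apply Rmax_r | exact H2]).
    assert (Hq : tau <= tau ^ 2) by (simpl; nra).
    assert (Hge : c / 2 * tau ^ 2 <= u T).
    { apply Rabs_def2 in H1. destruct H1 as [_ H1].
      apply Rle_div_r; [apply pow_lt; lra|]. lra. }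
    split; [|assumption]. apply Rlt_div_l in Ht2; [|assumption]. nra. }
  destruct (Einf_ffall_asymptotic J m) as (C & HC & Hasym).
  assert (H1 : tends (fun T => Einf J (Htime r T) (fun eta => ffall (hh J (Htime r T) eta (Hpos J s r T)) m) / u T ^ m) 1).
  { apply tends_squeeze with (g := fun _ => 1) (d := fun T => (C / sqrt (c / 2)) / Rpower T (1 / 4)).
    - apply tends_const.
    - apply tends_inv_quarter.
    - eapply eventually_T_imp; [|exact (eventually_T_and _ _ Hlarge (Rpower_quarter_large 1))].
      intros T [[Hu2 Hge] [HT Htau]]. eapply Rle_trans; [apply Hasym; exact Hu2|]. fold (u T).
      set (tau := Rpower T (1 / 4)) in *.
      assert (Hs : 0 < sqrt (c / 2)) by (apply sqrt_lt_R0; lra).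
      replace (C / sqrt (c / 2) / tau) with (C / (sqrt (c / 2) * tau)) by (field; lra).
      apply Rmult_le_compat_l; [assumption|]. apply Rinv_le_contravar; [nra|].
      replace tau with (sqrt (tau ^ 2)) by (rewrite <- Rsqr_pow2, sqrt_Rsqr; lra).
      rewrite <- sqrt_mult by (try apply pow2_ge_0; lra). apply sqrt_le_1; [|lra|assumption].
      apply Rmult_le_pos; [lra | apply pow2_ge_0]. }
  rewrite <- (Rmult_1_l (c ^ m)).
  eapply tends_ext; [|exact (tends_mult _ _ _ _ H1 (tends_pow _ _ m Hu))].
  eapply eventually_T_imp; [|exact Hlarge]. intros T [H2 _]. cbv beta. fold (u T).
  unfold Rdiv. rewrite Rpow_mult_distr, pow_inv, pow_mult. field.
  split; apply pow_nonzero; [apply pow_nonzero, Rgt_not_eq, exp_pos | lra].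
Qed.

(* The left side is controlled by the product with one more factor, whose mean is known. *)
Lemma pair_product_gap m K e Y b (al be : nat -> R) :
  1 <= K -> 0 <= e <= 1 -> 0 <= Y -> Rabs b <= K ->
  (forall j, (j <= m)%nat -> Rabs (al j) <= K * e /\ Rabs (be j - b) <= K * e /\ Rabs (be j) <= K) ->
  Rabs (Y ^ m * (Y + b) ^ m - prodR (fun j => (Y + al j) * (Y + be j)) m)
  <= INR m * (2 * K * e) * (4 ^ S m * prodR (fun j => (Y + al j) * (Y + be j)) (S m)
        + (1 + 4 ^ S m) * (16 * K ^ 2) ^ S m).
Proof.
  intros HK He HY Hb Hj. set (f := fun j => (Y + al j) * (Y + be j)).
  (* [W] bounds every pair of factors, and since [K >= 1] also every single one. *)
  set (W := (Y + K) ^ 2).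
  assert (HW : Y + K <= W) by (unfold W; simpl; nra).
  assert (Hal : forall j, (j <= m)%nat -> Rabs (al j) <= K).
  { intros j Hjm. destruct (Hj j Hjm) as (H & _). eapply Rle_trans; [exact H|]. nra. }
  assert (Hsh : forall z, Rabs z <= K -> Rabs (Y + z) <= Y + K).
  { intros z Hz. eapply Rle_trans; [apply Rabs_triang|]. rewrite (Rabs_pos_eq Y HY). lra. }
  assert (Hprod : forall x y, Rabs x <= K -> Rabs y <= K -> Rabs ((Y + x) * (Y + y)) <= W).
  { intros x y Hx Hy. rewrite Rabs_mult. unfold W. replace ((Y + K) ^ 2) with ((Y + K) * (Y + K)) by ring.
    apply Rmult_le_compat; auto using Rabs_pos. }
  assert (HfW : forall j, (j < S m)%nat -> Rabs (f j) <= W).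
  { intros j Hjm. apply Hprod; [apply Hal | apply Hj]; lia. }
  (* If [Y >= 3 K], every factor is at least [(Y + K) / 2], so the product is at least
     [(W / 4) ^ S m]. Otherwise [W <= 16 K^2] and the product, possibly negative, is bounded; the
     added constant covers both cases. *)
  assert (Hbound : W ^ S m <= 4 ^ S m * prodR f (S m) + (1 + 4 ^ S m) * (16 * K ^ 2) ^ S m).
  { assert (H4 : 0 < 4 ^ S m) by (apply pow_lt; lra).
    assert (HC : 0 <= (16 * K ^ 2) ^ S m) by (apply pow_le; simpl; nra).
    destruct (Rle_lt_dec (3 * K) Y) as [Hlarge|Hsmall].
    - assert (G : (W / 4) ^ S m <= prodR f (S m)).
      { apply prodR_lower; [unfold W; pose proof (pow2_ge_0 (Y + K)); lra|].
        intros j Hjm. unfold f, W. pose proof (Hal j ltac:(lia)) as Ha.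
        destruct (Hj j ltac:(lia)) as (_ & _ & Hbe).
        apply Rabs_le_between in Ha. apply Rabs_le_between in Hbe.
        replace ((Y + K) ^ 2 / 4) with ((Y + K) / 2 * ((Y + K) / 2)) by field.
        apply Rmult_le_compat; lra. }
      replace (W ^ S m) with (4 ^ S m * (W / 4) ^ S m) by (rewrite <- Rpow_mult_distr; f_equal; field).
      assert (4 ^ S m * (W / 4) ^ S m <= 4 ^ S m * prodR f (S m)) by (apply Rmult_le_compat_l; lra).
      nra.
    - assert (HWs : W ^ S m <= (16 * K ^ 2) ^ S m).
      { apply pow_incr. split; [apply pow2_ge_0|]. unfold W.
        replace (16 * K ^ 2) with ((4 * K) ^ 2) by ring. apply pow_incr. lra. }
      pose proof (prodR_bound f (S m) W HfW) as G. apply Rabs_le_between in G.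
      assert (4 ^ S m * - (16 * K ^ 2) ^ S m <= 4 ^ S m * prodR f (S m)) by (apply Rmult_le_compat_l; lra).
      lra. }
  replace (Y ^ m * (Y + b) ^ m) with (prodR (fun _ => Y * (Y + b)) m)
    by (rewrite prodR_const, Rpow_mult_distr; reflexivity).
  rewrite Rabs_minus_sym.
  eapply Rle_trans; [apply (prodR_perturb _ _ m (2 * K * e * W) W); [lra|]|].
  - intros j Hjm. destruct (Hj j ltac:(lia)) as (H1 & H2 & H3). repeat split.
    + unfold f. replace ((Y + al j) * (Y + be j) - Y * (Y + b)) with (al j * (Y + be j) + Y * (be j - b)) by ring.
      eapply Rle_trans; [apply Rabs_triang|]. rewrite !Rabs_mult, (Rabs_pos_eq Y HY).
      assert (Rabs (al j) * Rabs (Y + be j) <= K * e * W).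
      { apply Rmult_le_compat; auto using Rabs_pos. eapply Rle_trans; [apply Hsh, H3 | exact HW]. }
      assert (Y * Rabs (be j - b) <= W * (K * e)) by (apply Rmult_le_compat; auto using Rabs_pos; lra).
      lra.
    + apply HfW. lia.
    + replace Y with (Y + 0) at 1 by ring. apply Hprod; [rewrite Rabs_R0; lra | assumption].
  - replace (INR m * (2 * K * e * W) * W ^ m) with (INR m * (2 * K * e) * W ^ S m) by (simpl; ring).
    apply Rmult_le_compat_l; [|exact Hbound].
    apply Rmult_le_pos; [apply pos_INR | nra].
Qed.

Lemma cluster_scaled g h a tau m : tau <> 0 ->
  cluster (facD g) h a 0 m / tau ^ (2 * m)
  = prodR (fun j => (h / tau + - (INR j / tau)) * (h / tau + ((a - h) / tau + (g + INR j) / tau))) m.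
Proof.
  intros Ht. rewrite cluster_prodR. induction m as [|m IH]; [simpl; field|].
  replace (2 * S m)%nat with (S (S (2 * m))) by lia. cbn [prodR]. rewrite <- IH.
  unfold facD. simpl Nat.add. rewrite <- !tech_pow_Rmult. field. split; [|apply pow_nonzero]; assumption.
Qed.

(** After scaling, the dual function is a product of pairs [Y + O(1/tau)] and
    [Y + s (J + 1) + O(1/tau)] with [Y] the rescaled height. The error against the required moment
    is [1/tau] times the dual function with [m + 1] particles plus a constant, and that function
    again has a convergent mean. *)
Theorem dynamic_moment_limit J s r g m : (1 <= J)%nat -> 0 < r -> INR J + 1 < g ->
  tends (fun T => Expect J g (Htime r T) (fun eta =>
            Hval J s r T eta ^ m * (Hval J s r T eta + s * (INR J + 1)) ^ m))
    (sqrt (r * INR J / (2 * PI)) ^ m * poch g m).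
Proof.
  intros HJ1 Hr Hg. assert (HJ : 1 <= INR J) by (apply (le_INR 1); lia).
  set (n := INR J + 1).
  set (F := fun m T => wsum (law J g (Htime r T)) (fun eta =>
     cluster (facD g) (hh J (Htime r T) eta (Hpos J s r T)) (aa J eta (Hpos J s r T)) 0 m
     / Rpower T (1 / 4) ^ (2 * m))).
  assert (HF : forall m, tends (F m) (sqrt (r * INR J / (2 * PI)) ^ m * poch g m)).
  { intros m'. eapply tends_ext; [|exact (tends_mult _ _ _ _ (ffall_moment_limit J s r m' HJ1 Hr) (tends_const (poch g m')))].
    exists 0. intros T _. unfold F.
    rewrite (wsum_ext _ _ (fun eta => / Rpower T (1 / 4) ^ (2 * m') *
       cluster (facD g) (hh J (Htime r T) eta (Hpos J s r T)) (aa J eta (Hpos J s r T)) 0 m')) by (intros; unfold Rdiv; ring).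
    rewrite wsum_scal, moment_comparison by assumption. unfold Einf, Rdiv. ring. }
  (* [K] bounds the shifts by [j <= m] and [g], the rounding error [3 n] of [aa - hh], and the
     limiting offset [s n]. *)
  set (K := INR m + 3 * n + g + Rabs (s * n) + 1).
  pose proof (pos_INR m) as Hm. pose proof (Rabs_pos (s * n)) as Hsn.
  assert (Hn : 2 <= n) by (unfold n; lra). assert (Hg0 : 0 < g) by lra.
  assert (HK : 1 <= K) by (unfold K; lra).
  set (C := (1 + 4 ^ S m) * (16 * K ^ 2) ^ S m).
  apply tends_squeeze with (g := F m)
    (d := fun T => (INR m * (2 * K)) / Rpower T (1 / 4) * (4 ^ S m * F (S m) T + C)).
  - apply HF.
  - set (L := sqrt (r * INR J / (2 * PI)) ^ S m * poch g (S m)).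
    replace 0 with (0 * (4 ^ S m * L + C)) by ring. apply tends_mult; [apply tends_inv_quarter|].
    apply tends_plus; [|apply tends_const]. apply tends_mult; [apply tends_const | apply HF].
  - eapply eventually_T_imp; [|exact (Hpos_spec J s r HJ1 Hr)].
    intros T (HT & Htau & Ex & Hk & Ht).
    set (tau := Rpower T (1 / 4)) in *. set (k := Hpos J s r T) in *. set (t := Htime r T) in *.
    assert (Hsupp : supported (law J g t) (valid J t))
      by (rewrite law_lawG; apply supported_lawG, admissible_dyn, Hg).
    assert (Hone : wsum (law J g t) (fun _ => 1) = 1)
      by (rewrite law_lawG; apply wsum_lawG_one, admissible_dyn, Hg).
    unfold F. fold tau k t. change (Expect J g t) with (wsum (law J g t)).
    set (G := fun eta => Hval J s r T eta ^ m * (Hval J s r T eta + s * n) ^ m).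
    set (P := fun m eta => cluster (facD g) (hh J t eta k) (aa J eta k) 0 m / tau ^ (2 * m)).
    change (Rabs (wsum (law J g t) G - wsum (law J g t) (P m)) <=
      INR m * (2 * K) / tau * (4 ^ S m * wsum (law J g t) (P (S m)) + C)).
    assert (Hgap : forall eta, valid J t eta ->
      Rabs (G eta - P m eta) <= INR m * (2 * K) / tau * (4 ^ S m * P (S m) eta + C)).
    { intros eta HV. unfold G, P, C.
      assert (EH : Hval J s r T eta = hh J t eta k / tau).
      { unfold Hval. fold tau t. fold tau in Ex. rewrite Ex, (hgt_hh J t) by (auto; lia). reflexivity. }
      rewrite EH, !cluster_scaled by lra.
      replace (INR m * (2 * K) / tau) with (INR m * (2 * K * / tau)) by (field; lra).
      assert (Hinv : 0 < / tau <= 1).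
      { split; [apply Rinv_0_lt_compat; lra|]. rewrite <- Rinv_1. apply Rinv_le_contravar; lra. }
      (* The difference [aa - hh] is the deterministic number [(J + 1) k - J t]. The centring
         [J r T / (J + 1)] cancels its part linear in [T], leaving [s n tau] and rounding errors of
         at most [2 n + J]. *)
      assert (HD : Rabs ((aa J eta k - hh J t eta k) / tau - s * n) <= 3 * n * / tau).
      { replace ((aa J eta k - hh J t eta k) / tau - s * n) with
          ((n * (INR k - (INR J * r * T / (INR J + 1) + s * tau)) - INR J * (INR t - r * T)) * / tau)
          by (unfold aa, hh, n; field; lra).
        rewrite Rabs_mult, (Rabs_pos_eq (/ tau)) by lra. apply Rmult_le_compat_r; [lra|].
        unfold Rminus at 1. eapply Rle_trans; [apply Rabs_triang|]. rewrite Rabs_Ropp, !Rabs_mult.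
        rewrite (Rabs_pos_eq n), (Rabs_pos_eq (INR J)) by (unfold n; lra).
        assert (n * Rabs (INR k - (INR J * r * T / (INR J + 1) + s * tau)) <= n * 2)
          by (apply Rmult_le_compat_l; unfold n in *; lra).
        assert (INR J * Rabs (INR t - r * T) <= INR J * 1) by (apply Rmult_le_compat_l; lra).
        unfold n in *; lra. }
      apply pair_product_gap; [assumption | lra | | unfold K; lra |].
      - apply Rdiv_le_0_compat; [now apply hh_nonneg | lra].
      - intros j Hj. assert (Hjm : INR j <= INR m) by (apply le_INR; lia). pose proof (pos_INR j) as Hj0.
        unfold Rdiv.
        assert (HB : Rabs ((aa J eta k - hh J t eta k) * / tau + (g + INR j) * / tau - s * n)
                     <= (3 * n + g + INR m) * / tau).
        { replace ((aa J eta k - hh J t eta k) * / tau + (g + INR j) * / tau - s * n) with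
            (((aa J eta k - hh J t eta k) / tau - s * n) + (g + INR j) * / tau) by (unfold Rdiv; ring).
          eapply Rle_trans; [apply Rabs_triang|].
          rewrite (Rabs_pos_eq ((g + INR j) * / tau)) by (apply Rmult_le_pos; lra).
          assert ((g + INR j) * / tau <= (g + INR m) * / tau) by (apply Rmult_le_compat_r; lra). lra. }
        repeat split.
        + rewrite Rabs_Ropp, Rabs_pos_eq by (apply Rmult_le_pos; lra).
          apply Rmult_le_compat_r; [lra|]. unfold K. lra.
        + eapply Rle_trans; [exact HB|]. apply Rmult_le_compat_r; [lra|]. unfold K. lra.
        + replace ((aa J eta k - hh J t eta k) * / tau + (g + INR j) * / tau)
            with (((aa J eta k - hh J t eta k) * / tau + (g + INR j) * / tau - s * n) + s * n) by ring.
          eapply Rle_trans; [apply Rabs_triang|].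
          assert ((3 * n + g + INR m) * / tau <= 3 * n + g + INR m).
          { rewrite <- (Rmult_1_r (3 * n + g + INR m)) at 2. apply Rmult_le_compat_l; lra. }
          unfold K. lra. }
    assert (EQ : forall c, wsum (law J g t) (fun eta => c * (INR m * (2 * K) / tau * (4 ^ S m * P (S m) eta + C)))
       = c * (INR m * (2 * K) / tau * (4 ^ S m * wsum (law J g t) (P (S m)) + C))).
    { intros c. rewrite !wsum_scal, wsum_plus, wsum_scal.
      rewrite (wsum_ext _ (fun _ => C) (fun _ => C * 1)) by (intros; ring).
      rewrite wsum_scal, Hone, Rmult_1_r. reflexivity. }
    replace (wsum (law J g t) G - wsum (law J g t) (P m)) with (wsum (law J g t) (fun eta => G eta - P m eta)).
    + apply Rabs_le. split.
      * pose proof (EQ (-1)) as E1.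
        replace (- (INR m * (2 * K) / tau * (4 ^ S m * wsum (law J g t) (P (S m)) + C))) with
          (-1 * (INR m * (2 * K) / tau * (4 ^ S m * wsum (law J g t) (P (S m)) + C))) by ring.
        rewrite <- E1. eapply wsum_le_supp; [exact Hsupp|]. intros eta HV.
        specialize (Hgap eta HV). apply Rabs_le_between in Hgap. lra.
      * pose proof (EQ 1) as E1.
        rewrite <- (Rmult_1_l (_ / tau * _)), <- E1. eapply wsum_le_supp; [exact Hsupp|]. intros eta HV.
        specialize (Hgap eta HV). apply Rabs_le_between in Hgap. lra.
    + rewrite (wsum_ext _ _ (fun eta => G eta + -1 * P m eta)) by (intros; ring).
      rewrite wsum_plus, wsum_scal. ring.
Qed.

Theorem theorem7p5 (m J : nat) (s r gamma : R) :
  (1 <= m)%nat -> (1 <= J)%nat -> 0 < r -> INR J + 1 < gamma ->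
  let L := Rpower (r * INR J / (2 * PI)) (INR m / 2) * poch gamma m in
  (forall eps, 0 < eps -> exists M, forall T, M < T ->
     Rabs (Expect J gamma (Htime r T)
             (fun eta => (Hval J s r T eta) ^ m *
                         (Hval J s r T eta + s * (INR J + 1)) ^ m) - L) < eps)
  /\
  (let a := gamma in let b := sqrt (2 * PI / (r * INR J)) in
   exists G, improper_integral0 (gamma_kernel a) G /\
     improper_integral0 (fun x => x ^ m * gamma_density a b G x) L).
Proof.
  intros Hm HJ Hr Hg L. assert (HJ1 : 1 <= INR J) by (apply (le_INR 1); lia). pose proof PI_RGT_0 as HPI.
  assert (Hpos : 0 < r * INR J / (2 * PI)) by (apply Rdiv_lt_0_compat; nra).
  assert (EL : L = sqrt (r * INR J / (2 * PI)) ^ m * poch gamma m).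
  { unfold L. f_equal. rewrite <- Rpower_sqrt, <- Rpower_pow, Rpower_mult by (try assumption; apply exp_pos).
    f_equal. field. }
  split.
  - rewrite EL. exact (dynamic_moment_limit J s r gamma m HJ Hr Hg).
  - cbv zeta.
    replace (2 * PI / (r * INR J)) with (/ (r * INR J / (2 * PI))) by (field; lra).
    rewrite sqrt_inv.
    destruct (gamma_moment gamma (/ sqrt (r * INR J / (2 * PI))) m) as (G & HG1 & HG2).
    + lra.
    + apply Rinv_0_lt_compat, sqrt_lt_R0, Hpos.
    + exists G. split; [exact HG1|].
      replace L with (poch gamma m / (/ sqrt (r * INR J / (2 * PI))) ^ m); [exact HG2|].
      rewrite EL, pow_inv. unfold Rdiv at 1. rewrite Rinv_inv. ring.
Qed.
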